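(* Let $(M,F)$ be a compact Finsler manifold. Suppose that $F$ has strictly positive (or strictly negative) isotropic Berwald curvature, i.e. there is a function $\Phi\in C^\infty(M)$ such that for all $x\in M$, $0\neq y\in T_xM$ and $u,v,w\in T_xM$, $$\mathbf{B}_y(u,v,w)=\Phi(x) F^{-1}\Big\{\mathbf{h}_y(u,v)\mathfrak{B}_y(w)+\mathbf{h}_y(v,w)\mathfrak{B}_y(u)+\mathbf{h}_y(w,u)\mathfrak{B}_y(v)+2F\,\mathbf{C}_y(u,v,w)\,\ell\Big\},$$ and a constant $c_0$ such that either $\Phi(x)\ge c_0>0$ for all $x\in M$, or $\Phi(x)\le c_0<0$ for all $x\in M$. Then $F$ is a Berwald metric.
   Context: Let $M$ be an $n$-dimensional $C^\infty$ manifold (without boundary), $TM_0=TM\setminus\{0\}$ the slit tangent bundle, with local coordinates $(x^i,y^i)$. A Finsler metric is a function $F:TM\to[0,\infty)$ that is $C^\infty$ on $TM_0$, satisfies $F(x,\lambda y)=\lambda F(x,y)$ for all $\lambda>0$, and such that for every $y\in T_xM\setminus\{0\}$ the form $\mathbf{g}_y(u,v)=\frac12\frac{\partial^2}{\partial s\partial t}F^2(y+su+tv)|_{s=t=0}$ is positive definite on $T_xM$; write $g_{ij}(x,y)$ for its components and $g^{ij}$ for the inverse matrix. The Cartan torsion is $\mathbf{C}_y(u,v,w)=\frac12\frac{d}{dt}[\mathbf{g}_{y+tw}(u,v)]_{t=0}$. The angular form is $\mathbf{h}_y(u,v)=\mathbf{g}_y(u,v)-F^{-2}(y)\mathbf{g}_y(y,u)\mathbf{g}_y(y,v)$.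 Also $\ell=\ell(x,y)=y/F(x,y)$ and $\mathfrak{B}_y(w)=w-\mathbf{g}_y(w,\ell)\ell$. The spray coefficients are $G^i=\frac14 g^{im}\left\{\frac{\partial^2 F^2}{\partial x^k\partial y^m}y^k-\frac{\partial F^2}{\partial x^m}\right\}$. The Berwald curvature is $\mathbf{B}_y(u,v,w)=B^i_{\ jkl}(y)u^jv^kw^l\frac{\partial}{\partial x^i}$ with $B^i_{\ jkl}=\frac{\partial^3G^i}{\partial y^j\partial y^k\partial y^l}$. $F$ is a Berwald metric if $\mathbf{B}=0$ on $TM_0$. *)

(* Defs.v *)
From HB Require Import structures.
From mathcomp Require Import all_boot all_order all_algebra.
From mathcomp Require Import all_classical all_reals all_analysis.

Set Implicit Arguments.
Unset Strict Implicit.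
Unset Printing Implicit Defensive.

Import Order.TTheory GRing.Theory Num.Theory.
Import numFieldNormedType.Exports.

Local Open Scope classical_set_scope.
Local Open Scope ring_scope.

(* [U] is meant to be open: the derivatives are those of the total function
   [f], and they depend only on its values near the points of [U]. *)
Fixpoint Ck (R : realType) (V W : normedModType R) (k : nat)
    (U : set V) (f : V -> W) : Prop :=
  if k is k'.+1 then
    (forall p, U p -> differentiable f p) /\ (forall v, Ck k' U ('D_v f))
  else forall p, U p -> {for p, continuous f}.

Definition smooth_on (R : realType) (V W : normedModType R)
    (U : set V) (f : V -> W) : Prop := forall k, Ck k U f.

(* A chart is given by its domain [dom i], its coordinate map [phi i] and a
   map [psi i] inverting it; [phi i] and [psi i] are total functions whose
   values outside [dom i] and [phi i @` dom i] are irrelevant. The atlas need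
   not be maximal. [chart_at x] is some chart around [x]. *)
Record manifold (R : realType) (n : nat) := Manifold {
  carrier :> topologicalType;
  carrier_hausdorff : hausdorff_space carrier;
  carrier_second_countable : @second_countable carrier;
  chart : Type;
  dom : chart -> set carrier;
  phi : chart -> carrier -> 'rV[R]_n;
  psi : chart -> 'rV[R]_n -> carrier;
  chart_at : carrier -> chart;
  dom_chart_at : forall x, dom (chart_at x) x;
  dom_open : forall i, open (dom i);
  cod_open : forall i, open (phi i @` dom i);
  phiK : forall i x, dom i x -> psi i (phi i x) = x;
  phi_continuous : forall i x, dom i x -> {for x, continuous (phi i)};
  psi_continuous : forall i p, (phi i @` dom i) p ->
    {for p, continuous (psi i)};
  transition_smooth : forall i j,
    smooth_on (phi i @` (dom i `&` dom j)) (phi j \o psi i)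
}.

Definition cod (R : realType) (n : nat) (M : manifold R n) (i : chart M) :
  set 'rV[R]_n := phi i @` dom i.

Definition smooth_fun (R : realType) (n : nat) (M : manifold R n)
    (f : M -> R) : Prop :=
  forall i : chart M, smooth_on (cod i) (f \o psi i).

(* A tangent vector at [x] is represented by its components in the chart
   [chart_at x]. As this chart varies with [x], joint smoothness on TM is not
   that of the product of [M] and R^n: it is expressed in the bundle charts
   provided by [tvec] below. *)
Definition tangent (R : realType) (n : nat) (M : manifold R n) (x : M) :
  lmodType R := 'rV[R]_n.

(* Components in the chart [i] of a tangent vector at [x]. *)
Definition tcoord (R : realType) (n : nat) (M : manifold R n) (i : chart M)
    (x : M) (u : tangent x) : 'rV[R]_n :=
  'd (phi i \o psi (chart_at x)) (phi (chart_at x) x) u.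

(* The tangent vector at [x] with components [v] in the chart [i]. *)
Definition tvec (R : realType) (n : nat) (M : manifold R n) (i : chart M)
    (x : M) (v : 'rV[R]_n) : tangent x :=
  'd (phi (chart_at x) \o psi i) (phi i x) v.

(* A function on TM in the coordinates (x^1..x^n, y^1..y^n) given by [i]. *)
Definition local_fun (R : realType) (n : nat) (M : manifold R n)
    (F : forall x : M, tangent x -> R) (i : chart M)
    (p : 'rV[R]_n * 'rV[R]_n) : R :=
  F (psi i p.1) (tvec i (psi i p.1) p.2).

Definition fund_tensor (R : realType) (n : nat) (M : manifold R n)
    (F : forall x : M, tangent x -> R) (x : M) (y u v : tangent x) : R :=
  2^-1 * derive1 (fun s : R =>
            derive1 (fun t : R => F x (y + s *: u + t *: v) ^+ 2 : R) 0 : R) 0.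

Definition finsler (R : realType) (n : nat) (M : manifold R n)
    (F : forall x : M, tangent x -> R) : Prop :=
  [/\ forall (x : M) (y : tangent x), 0 <= F x y,
      forall i : chart M,
        smooth_on [set p | cod i p.1 /\ p.2 != 0] (local_fun F i),
      forall (x : M) (y : tangent x) (lambda : R), 0 < lambda ->
        F x (lambda *: y) = lambda * F x y
    & forall (x : M) (y : tangent x), y != 0 ->
        forall u : tangent x, u != 0 -> 0 < fund_tensor F y u u].

Definition cartan_torsion (R : realType) (n : nat) (M : manifold R n)
    (F : forall x : M, tangent x -> R) (x : M) (y u v w : tangent x) : R :=
  2^-1 * derive1 (fun t : R => fund_tensor F (y + t *: w) u v) 0.

Definition angular_form (R : realType) (n : nat) (M : manifold R n)
    (F : forall x : M, tangent x -> R) (x : M) (y u v : tangent x) : R :=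
  fund_tensor F y u v
  - (F x y) ^- 2 * fund_tensor F y y u * fund_tensor F y y v.

Definition ell (R : realType) (n : nat) (M : manifold R n)
    (F : forall x : M, tangent x -> R) (x : M) (y : tangent x) : tangent x :=
  (F x y)^-1 *: y.

Definition frakB (R : realType) (n : nat) (M : manifold R n)
    (F : forall x : M, tangent x -> R) (x : M) (y w : tangent x) : tangent x :=
  w - fund_tensor F y w (ell F y) *: ell F y.

Definition dx (R : realType) (n : nat) (k : 'I_n)
    (f : 'rV[R]_n * 'rV[R]_n -> R) : 'rV[R]_n * 'rV[R]_n -> R :=
  'D_(delta_mx 0 k, 0) f.

Definition dy (R : realType) (n : nat) (k : 'I_n)
    (f : 'rV[R]_n * 'rV[R]_n -> R) : 'rV[R]_n * 'rV[R]_n -> R :=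
  'D_(0, delta_mx 0 k) f.

Definition fund_mx (R : realType) (n : nat) (M : manifold R n)
    (F : forall x : M, tangent x -> R) (i : chart M)
    (p : 'rV[R]_n * 'rV[R]_n) : 'M[R]_n :=
  let x := psi i p.1 in
  \matrix_(j, k) fund_tensor F (tvec i x p.2)
    (tvec i x (delta_mx 0 j)) (tvec i x (delta_mx 0 k)).

Definition spray (R : realType) (n : nat) (M : manifold R n)
    (F : forall x : M, tangent x -> R) (i : chart M) (a : 'I_n)
    (p : 'rV[R]_n * 'rV[R]_n) : R :=
  let F2 q := local_fun F i q ^+ 2 in
  4^-1 * \sum_(m < n) invmx (fund_mx F i p) a m *
    (\sum_(k < n) dx k (dy m F2) p * p.2 0 k - dx m F2 p).

Definition berwald_coef (R : realType) (n : nat) (M : manifold R n)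
    (F : forall x : M, tangent x -> R) (i : chart M) (a j k l : 'I_n)
    (p : 'rV[R]_n * 'rV[R]_n) : R :=
  dy j (dy k (dy l (spray F i a))) p.

(* The Berwald curvature computed in the chart [i], which should be a chart
   around [x]; the result does not depend on the choice of such a chart. *)
Definition berwald_curvature (R : realType) (n : nat) (M : manifold R n)
    (F : forall x : M, tangent x -> R) (i : chart M)
    (x : M) (y u v w : tangent x) : tangent x :=
  tvec i x (\row_a \sum_(j < n) \sum_(k < n) \sum_(l < n)
    berwald_coef F i a j k l (phi i x, tcoord i y)
    * tcoord i u 0 j * tcoord i v 0 k * tcoord i w 0 l).

Definition berwald_metric (R : realType) (n : nat) (M : manifold R n)
    (F : forall x : M, tangent x -> R) : Prop :=
  forall (i : chart M) (x : M), dom i x ->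
  forall y : tangent x, y != 0 ->
  forall u v w : tangent x, berwald_curvature F i y u v w = 0.

Definition isotropic_berwald (R : realType) (n : nat) (M : manifold R n)
    (F : forall x : M, tangent x -> R) (Phi : M -> R) : Prop :=
  forall (i : chart M) (x : M), dom i x ->
  forall y : tangent x, y != 0 ->
  forall u v w : tangent x,
    berwald_curvature F i y u v w =
    (Phi x * (F x y)^-1) *:
      (angular_form F y u v *: frakB F y w
       + angular_form F y v w *: frakB F y u
       + angular_form F y w u *: frakB F y v
       + (2 * F x y * cartan_torsion F y u v w) *: ell F y).

(* Main.v *)
(* Write a = F^2 and let S be the geodesic spray, seen as a derivation along
   (y, -2 G). Contracting the isotropy condition with y gives, in a chart,
   G^i_uuu a_i = Phi F a_uuu, and the Euler-Lagrange equations S(a_v) = a_{x^v}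
   then say that along S, for u transported by -N u = -(D_u G^i), the quantities
   a and a_uu are constant while a_uuu has logarithmic derivative -Phi F.
   The ratio a (a_uuu)^2 / (a_uu)^3 is homogeneous of degree 0 in y and in u, so
   by compactness of M it has a maximum on the nonzero pairs (y, u); there its
   derivative along this flow, -2 Phi F times the ratio, must vanish. As Phi has
   no zero, the ratio vanishes identically, and so does the Cartan torsion. Then
   a is quadratic in y, and differentiating the Euler-Lagrange equations three
   times in y gives that the third derivatives of G are zero. No geodesic is
   ever integrated. *)

Require Import Defs.
From HB Require Import structures.
From mathcomp Require Import all_boot all_order perm all_algebra.
From mathcomp Require Import all_classical all_reals all_analysis.
From mathcomp Require Import ring lra.

Set Implicit Arguments.
Unset Strict Implicit.
Unset Printing Implicit Defensive.

Import Order.TTheory GRing.Theory Num.Theory.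
Import numFieldNormedType.Exports.

Local Open Scope classical_set_scope.
Local Open Scope ring_scope.

(** * Symmetry of second derivatives *)

(** The exponents of the ratio are forced up to a common power: in [y] the factors [a], [a_uuu],
    [a_uu] have degrees 2, -1, 0, and in [u] degrees 0, 3, 2. Since [a] and [a_uu] are positive, the
    square makes the ratio nonnegative, so a maximum that is at most 0 kills it everywhere, and both
    signs of Phi are treated alike. The first-order condition at a maximum sees only the velocity of
    the flow. The flow line can therefore be replaced by a straight line in one chart,
    [t |-> (q + t (y, -2 G), u - t N u)] with [G] and [N] frozen at [t = 0]; this is what removes
    every differential equation. Along that line the ratio is compared with its maximum [M] in the
    form [a a_uuu^2 - M a_uu^3], which needs no quotient rule. The identities along [S] all come
    from commuting directional derivatives, so symmetry of second derivatives is established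
    first. *)

(** In [g = f + (g - f)] the second summand vanishes near [x], so its expansion has the zero map as
    linear part. *)
Lemma near_eq_differentiable (R : realType) (V W : normedModType R)
    (f g : V -> W) (x : V) :
  (\near x, f x = g x) -> differentiable f x -> differentiable g x.
Proof.
move=> fg df; have -> : g = f + (g - f).
  by apply/funext => y; rewrite !fctE addrC subrK.
apply: differentiableD => //.
set h := g - f.
have h0 : \near x, h x = 0.
  by near=> y; rewrite /h !fctE (near fg y)// subrr.
have hl : h \o shift x = cst (h x) + (\0 : V -> W) +o_ 0 id.
  apply/eqaddoP => _/posnumP[e].
  have h0' : \forall y \near 0, h (y + x) = 0.
    by move: h0; rewrite (near_shift 0)/=; apply: filterS => y; rewrite subr0.
  near=> y; rewrite !fctE /= (near h0' y)// (nbhs_singleton h0) !addr0 subr0 normr0.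
  by rewrite mulr_ge0.
have ch : continuous (\0 : V -> W) by move=> y; apply: cvg_cst.
have dh := diff_unique ch hl.
by apply/diff_locallyP; rewrite dh; split.
Unshelve. all: by end_near. Qed.

Lemma is_derive_line (R : realType) (V W : normedModType R) (f : V -> W)
    (q u : V) (s : R) :
  differentiable f (q + s *: u) ->
  is_derive s 1 (fun s : R => f (q + s *: u)) ('D_u f (q + s *: u)).
Proof.
move=> df.
have dl : is_diff s (fun s : R => q + s *: u) (fun s => s *: u).
  have -> : (fun s : R => q + s *: u) = cst q + ( *:%R^~ u) by [].
  by apply: is_diff_eq => //; rewrite add0r.
have dc : differentiable (f \o (fun s : R => q + s *: u)) s.
  exact: differentiable_comp.
apply: DeriveDef; first exact/derivable1_diffP.
by rewrite deriveE// diff_comp//= diff_val scale1r deriveE.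
Qed.

Lemma differentiable_near_bound (R : realType) (V W : normedModType R)
    (f : V -> W) (q : V) (e : R) : differentiable f q -> 0 < e ->
  \forall h \near (0 : V), `|f (q + h) - f q - 'D_h f q| <= e * `|h|.
Proof.
move=> df e0; have [_ fl] := (diff_locallyxP q f).1 df.
have /eqaddoP : (fun h => f (h + q)) = (fun h => f q + 'd f q h) +o_ (0:V) id.
  exact/funext.
move=> /(_ e e0); apply: filterS => h /=; rewrite !fctE.
by rewrite deriveE// addrC -addrA -opprD addrC [q + h]addrC.
Qed.

Lemma near_square (R : realType) (V : normedModType R) (u v : V) (P : set V) :
  nbhs (0 : V) P -> \forall t \near (0 : R)^'+, 0 < t /\
    forall s r : R, 0 <= s <= t -> 0 <= r <= t -> P (s *: u + r *: v).
Proof.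
move=> /nbhs_ballP[e /= e0 eP].
pose M := `|u| + `|v| + 1.
have M0 : 0 < M by rewrite /M ltr_wpDl// addr_ge0.
near=> t; have t0 : 0 < t by [].
split => // s r /andP[s0 st] /andP[r0 rt]; apply: eP.
rewrite -ball_normE /= sub0r normrN.
have tM : t * M < e by rewrite -ltr_pdivlMr//; near: t; exact/nbhs_right_lt/divr_gt0.
apply: le_lt_trans tM; apply: le_trans (ler_normD _ _) _.
rewrite !normrZ !ger0_norm// /M.
have : s * `|u| <= t * `|u| by exact: ler_wpM2r.
have : r * `|v| <= t * `|v| by exact: ler_wpM2r.
rewrite !mulrDr mulr1; lra.
Unshelve. all: by end_near. Qed.

(** Young's argument: the mean value theorem in the direction [u] turns the second difference into
    [t] times a difference of two values of ['D_u f], and differentiability of ['D_u f] at the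
    single point [q] expands both. *)
Lemma second_difference (R : realType) (V : normedModType R) (f : V -> R)
    (q u v : V) (e : R) :
  (\near q, differentiable f q) -> differentiable ('D_u f) q -> 0 < e ->
  \forall t \near (0 : R)^'+,
   `|f (q + t *: u + t *: v) - f (q + t *: u) - f (q + t *: v) + f q
     - t ^+ 2 * 'D_v ('D_u f) q| <= e * t ^+ 2.
Proof.
move=> df dDf e0.
have df' : \forall h \near (0 : V), differentiable f (q + h).
  by move: df; rewrite (near_shift 0)/=; apply: filterS => y; rewrite subr0 /= addrC.
(* The two expansion errors are at most [e / M] times [|s u + t v|] and [|s u|], whose sum is at
   most [t (2 |u| + |v|)]; the 1 keeps [M] positive. *)
pose M := 2 * `|u| + `|v| + 1.
have M0 : 0 < M by rewrite /M ltr_wpDl// addr_ge0// mulr_ge0.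
have eM0 : 0 < e / M by exact: divr_gt0.
have bnd := differentiable_near_bound dDf eM0.
have Pn : nbhs (0 : V) (fun h => differentiable f (q + h) /\
  `|'D_u f (q + h) - 'D_u f q - 'D_h ('D_u f) q| <= e / M * `|h|).
  exact: filterI.
near=> t.
have [t0 Pt] : 0 < t /\
    forall s r : R, 0 <= s <= t -> 0 <= r <= t ->
   (fun h => differentiable f (q + h) /\
  `|'D_u f (q + h) - 'D_u f q - 'D_h ('D_u f) q| <= e / M * `|h|) (s *: u + r *: v).
  by near: t; exact: (near_square u v Pn).
have t0t : 0 <= t <= t by rewrite (ltW t0) lexx.
have t00 : 0 <= (0 : R) <= t by rewrite (ltW t0) lexx.
pose g s := f (q + t *: v + s *: u) - f (q + s *: u).
have dg s : 0 <= s <= t -> is_derive s 1 g ('D_u f (q + t *: v + s *: u) - 'D_u f (q + s *: u)).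
  move=> st.
  have l (p : V) : differentiable f (p + s *: u) ->
    is_derive s 1 (fun s : R => f (p + s *: u)) ('D_u f (p + s *: u)).
    exact: is_derive_line.
  apply: is_deriveB; apply: l.
    by rewrite -addrA [t *: v + _]addrC; exact: (Pt _ _ st t0t).1.
  by rewrite -[s *: u]addr0 -(scale0r v); exact: (Pt _ _ st t00).1.
have [s sin gE] : exists2 c, c \in `]0, t[ & g t - g 0 =
   ('D_u f (q + t *: v + c *: u) - 'D_u f (q + c *: u)) * (t - 0).
  apply: MVT => //.
    by move=> x; rewrite in_itv/= => /andP[x0 xt]; apply: dg; rewrite !ltW.
  apply: derivable_within_continuous => x; rewrite in_itv/= => xt.
  exact: (@ex_derive _ _ _ _ _ _ _ (dg _ xt)).
have {}st : 0 <= s <= t by move: sin; rewrite in_itv/= => /andP[? ?]; rewrite !ltW.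
have [_ b1] := Pt _ _ st t0t.
have [_ b2] := Pt _ _ st t00.
rewrite scale0r addr0 in b2.
have -> : f (q + t *: u + t *: v) - f (q + t *: u) - f (q + t *: v) + f q = g t - g 0.
  by rewrite /g !scale0r !addr0 [q + t *: u + _]addrAC; ring.
have lin : 'D_(s *: u + t *: v) ('D_u f) q = 'D_(s *: u) ('D_u f) q + t * 'D_v ('D_u f) q.
  by rewrite !deriveE// linearD linearZ /= linearZ.
move: b1; rewrite lin gE subr0 addrA [q + t *: v + _]addrAC => b1.
set A := 'D_u f (q + s *: u + t *: v) in b1 *.
set B := 'D_u f (q + s *: u) in b2 *.
set D := 'D_v _ _ in b1 *.
set C := 'D_(s *: u) _ _ in b1 b2.
have -> : (A - B) * t - t ^+ 2 * D = t * (A - B - t * D) by ring.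
rewrite normrM (gtr0_norm t0) expr2 mulrCA ler_pM2l//.
have -> : A - B - t * D = (A - 'D_u f q - (C + t * D)) - (B - 'D_u f q - C) by ring.
apply: le_trans (ler_normB _ _) _.
apply: le_trans (lerD b1 b2) _; rewrite -mulrDr -mulrA ler_pM2l//.
rewrite ler_pdivrMl//.
have h1 : `|s *: u + t *: v| <= t * `|u| + t * `|v|.
  apply: le_trans (ler_normD _ _) _; rewrite !normrZ (gtr0_norm t0) lerD2r.
  by case/andP: st => s0 st; rewrite ger0_norm// ler_wpM2r.
have h2 : `|s *: u| <= t * `|u|.
  by case/andP: st => s0 st; rewrite normrZ ger0_norm// ler_wpM2r.
apply: le_trans (lerD h1 h2) _.
have -> : M * t = 2 * (t * `|u|) + t * `|v| + t by rewrite /M; ring.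
by move: (t * `|u|) (t * `|v|) (ltW t0) => x y; clear; lra.
Unshelve. all: by end_near. Qed.

(** The second difference is symmetric in [u] and [v], and divided by [t ^+ 2] it approaches both
    mixed derivatives. *)
Lemma derive_comm (R : realType) (V : normedModType R) (f : V -> R) (q u v : V) :
  (\near q, differentiable f q) -> differentiable ('D_u f) q ->
  differentiable ('D_v f) q -> 'D_v ('D_u f) q = 'D_u ('D_v f) q.
Proof.
move=> df du dv; apply/eqP; rewrite -subr_eq0 -normr_le0; apply/ler_addgt0Pl => e e0.
rewrite addr0.
have e2 : 0 < e / 2 by rewrite divr_gt0.
have [t [t0 h1 h2]] : exists t : R, [/\ 0 < t,
   `|f (q + t *: u + t *: v) - f (q + t *: u) - f (q + t *: v) + f q
     - t ^+ 2 * 'D_v ('D_u f) q| <= e / 2 * t ^+ 2 &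
   `|f (q + t *: v + t *: u) - f (q + t *: v) - f (q + t *: u) + f q
     - t ^+ 2 * 'D_u ('D_v f) q| <= e / 2 * t ^+ 2].
  have h1 := second_difference v df du e2.
  have h2 := second_difference u df dv e2.
  have h0 : \forall t \near (0 : R)^'+, 0 < t by exact: nbhs_right_gt.
  have [t [[k1 k2] k0]] := filter_ex (filterI (filterI h1 h2) h0).
  by exists t; exact: And3 k0 k1 k2.
have t20 : 0 < t ^+ 2 by rewrite exprn_gt0.
rewrite -(ler_pM2l t20) -[in X in X <= _](gtr0_norm t20) -normrM.
rewrite [q + t *: v + _]addrAC in h2.
move: h1 h2.
move: (f (q + t *: u + t *: v)) (f (q + t *: u)) (f (q + t *: v)) (f q) => A B C D.
move: ('D_v ('D_u f) q) ('D_u ('D_v f) q) => X Y h1 h2.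
have -> : t ^+ 2 * (X - Y) = (A - C - B + D - t ^+ 2 * Y) -
  (A - B - C + D - t ^+ 2 * X) by ring.
apply: le_trans (ler_normB _ _) _; apply: le_trans (lerD h2 h1) _.
by rewrite -mulrDl -splitr mulrC.
Qed.

(** * Smooth real functions on an open set *)

Section SmoothRealFunctions.
Context (R : realType) (V : normedModType R) (U : set V).
Hypothesis oU : open U.
Implicit Types f g : V -> R.

Let nearU (p : V) (P : V -> Prop) : U p -> (forall q, U q -> P q) -> \near p, P p.
Proof. by move=> Up UP; apply: filterS (open_nbhs_nbhs (conj oU Up)). Qed.

Lemma derive_on_open f g (p v : V) : U p -> (forall q, U q -> f q = g q) ->
  'D_v f p = 'D_v g p.
Proof. by move=> Up fg; apply: near_eq_derive; exact: nearU. Qed.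

Lemma Ck_ext k f g : (forall q, U q -> f q = g q) -> Ck k U f -> Ck k U g.
Proof.
elim: k f g => [|k IH] f g fg /=.
  move=> cf p Up; have fgp : \near p, f p = g p by exact: nearU.
  rewrite /prop_for /continuous_at -(fg p Up).
  by apply: cvg_trans (cf p Up); apply: near_eq_cvg; apply: filterS fgp => q ->.
move=> [df cf]; split.
  by move=> p Up; apply: near_eq_differentiable (df p Up); exact: nearU.
by move=> v; apply: IH (cf v) => q Uq; exact: derive_on_open.
Qed.

Lemma smooth_ext f g : (forall q, U q -> f q = g q) ->
  smooth_on U f -> smooth_on U g.
Proof. by move=> fg sf k; apply: Ck_ext fg (sf k). Qed.

Lemma smooth_derive f v : smooth_on U f -> smooth_on U ('D_v f).
Proof. by move=> sf k; have [_] := sf k.+1; apply. Qed.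

Lemma smooth_differentiable f p : smooth_on U f -> U p -> differentiable f p.
Proof. by move=> sf; have [+ _] := sf 1; apply. Qed.

Lemma smooth_derivable f p v : smooth_on U f -> U p -> derivable f p v.
Proof. by move=> sf Up; exact/diff_derivable/smooth_differentiable. Qed.

Lemma smooth_continuous f p : smooth_on U f -> U p -> {for p, continuous f}.
Proof. by move=> sf; exact: (sf 0). Qed.

Lemma smooth_derive_comm f p u v : smooth_on U f -> U p ->
  'D_u ('D_v f) p = 'D_v ('D_u f) p.
Proof.
move=> sf Up; apply: derive_comm.
- by apply: nearU => // q; exact: smooth_differentiable.
- exact/smooth_differentiable/Up/smooth_derive.
- exact/smooth_differentiable/Up/smooth_derive.
Qed.

Lemma smooth_deriveD f g p v : smooth_on U f -> smooth_on U g -> U p ->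
  'D_v (fun q => f q + g q) p = 'D_v f p + 'D_v g p.
Proof. by move=> sf sg Up; apply: deriveD; exact: smooth_derivable. Qed.

Lemma smooth_deriveM f g p v : smooth_on U f -> smooth_on U g -> U p ->
  'D_v (fun q => f q * g q) p = 'D_v f p * g p + f p * 'D_v g p.
Proof.
move=> sf sg Up; rewrite [LHS](deriveM (smooth_derivable sf Up) (smooth_derivable sg Up)).
by rewrite addrC mulrC.
Qed.

Lemma smooth_cst (c : R) : smooth_on U (fun=> c : R).
Proof.
move=> k; elim: k c => [|k IH] c /=; first by move=> p _; exact: cvg_cst.
split=> [p _|v]; first exact: differentiable_cst.
by apply: Ck_ext (IH 0) => q _; rewrite derive_cst.
Qed.

Lemma smooth_lin (f : {linear V -> R}) : continuous f -> smooth_on U f.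
Proof.
move=> cf [|k] /=; first by move=> p _; exact: cf.
split=> [p _|v]; first exact: linear_differentiable.
apply: Ck_ext (smooth_cst (f v) k) => q _.
by rewrite deriveE ?diff_lin//; exact: linear_differentiable.
Qed.

Lemma CkD k f g : Ck k U f -> Ck k U g -> Ck k U (fun q => f q + g q).
Proof.
elim: k f g => [|k IH] f g /=.
  by move=> cf cg p Up; apply: continuousD; [exact: cf|exact: cg].
move=> [df cf] [dg cg]; split=> [p Up|v].
  by apply: differentiableD; [exact: df|exact: dg].
apply: Ck_ext (IH _ _ (cf v) (cg v)) => q Uq.
rewrite -[RHS]/('D_v (f + g) q) deriveD//.
  exact/diff_derivable/df.
exact/diff_derivable/dg.
Qed.

Lemma smoothD f g : smooth_on U f -> smooth_on U g ->
  smooth_on U (fun q => f q + g q).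
Proof. by move=> sf sg k; apply: CkD. Qed.

(** The product rule at order [k.+1] involves the undifferentiated factors at order [k]. *)
Lemma Ck_pred k f : Ck k.+1 U f -> Ck k U f.
Proof.
elim: k f => [|k IH] f [df cf]; first by move=> p Up; exact/differentiable_continuous/df.
by split => // v; exact: IH.
Qed.

Lemma CkM k f g : Ck k U f -> Ck k U g -> Ck k U (fun q => f q * g q).
Proof.
elim: k f g => [|k IH] f g cf cg.
  by move=> p Up; apply: continuousM; [exact: cf|exact: cg].
have cf' := Ck_pred cf; have cg' := Ck_pred cg.
case: cf cg => [df cf] [dg cg]; split=> [p Up|v].
  by apply: differentiableM; [exact: df|exact: dg].
apply: Ck_ext (CkD (IH _ _ (cf v) cg') (IH _ _ cf' (cg v))) => q Uq.
rewrite -[RHS]/('D_v (f * g) q) deriveM; first by rewrite [LHS]addrC; congr (_ + _); exact: mulrC.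
  exact/diff_derivable/df.
exact/diff_derivable/dg.
Qed.

Lemma smoothM f g : smooth_on U f -> smooth_on U g ->
  smooth_on U (fun q => f q * g q).
Proof. by move=> sf sg k; apply: CkM. Qed.

Lemma smoothN f : smooth_on U f -> smooth_on U (fun q => - f q).
Proof.
move=> sf; apply: smooth_ext (smoothM (smooth_cst (- 1)) sf) => q _.
by rewrite mulN1r.
Qed.

Lemma smoothB f g : smooth_on U f -> smooth_on U g ->
  smooth_on U (fun q => f q - g q).
Proof. by move=> sf sg; apply: smoothD => //; exact: smoothN. Qed.

Lemma smoothV f : (forall q, U q -> f q != 0) -> smooth_on U f ->
  smooth_on U (fun q => (f q)^-1).
Proof.
move=> f0 sf; elim=> [|k IH] /=.
  by move=> p Up; apply: continuousV; [exact: f0|exact: smooth_continuous].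
split=> [p Up|v].
  by apply: differentiableV; [exact: smooth_differentiable|exact: f0].
apply: Ck_ext (CkM (smoothN (smooth_derive v sf) k) (CkM IH IH)) => q Uq.
rewrite deriveV ?f0//; last exact: smooth_derivable.
by rewrite -[RHS]/(- (f q) ^- 2 * 'D_v f q) -exprVn; ring.
Qed.

Lemma smooth_sum (I : finType) (f : I -> V -> R) :
  (forall i, smooth_on U (f i)) -> smooth_on U (fun q => \sum_i f i q).
Proof.
move=> sf; rewrite unlock; elim: (index_enum I) => [|i r IH] /=; first exact: smooth_cst.
exact: smoothD.
Qed.

Lemma smooth_prod (I : finType) (f : I -> V -> R) :
  (forall i, smooth_on U (f i)) -> smooth_on U (fun q => \prod_i f i q).
Proof.
move=> sf; rewrite unlock; elim: (index_enum I) => [|i r IH] /=; first exact: smooth_cst.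
exact: smoothM.
Qed.

Lemma smooth_derive_sum (I : finType) (f : I -> V -> R) p v :
  (forall i, smooth_on U (f i)) -> U p ->
  'D_v (fun q => \sum_i f i q) p = \sum_i 'D_v (f i) p.
Proof.
move=> sf Up; rewrite unlock.
(* The induction over the list of indices needs the partial sums to be smooth, so smoothness is
   carried along. *)
suff [] : smooth_on U (fun q => reducebig 0 (index_enum I) (fun i => BigBody i +%R true (f i q))) /\
  'D_v (fun q => reducebig 0 (index_enum I) (fun i => BigBody i +%R true (f i q))) p =
  reducebig 0 (index_enum I) (fun i => BigBody i +%R true ('D_v (f i) p)) by [].
elim: (index_enum I) => [|i r [IH1 IH2]] /=.
  by split; [exact: smooth_cst|rewrite derive_cst].
by split; [exact: smoothD|rewrite smooth_deriveD// IH2].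
Qed.

End SmoothRealFunctions.

(** Both sides are the limit of the same difference quotient, so the identity holds for arbitrary
    [f]. It translates the one-variable derivatives defining [fund_tensor] and [cartan_torsion]. *)
Lemma derive1_line (R : realType) (V W : normedModType R) (f : V -> W) (q w : V) :
  derive1 (fun t : R => f (q + t *: w)) 0 = 'D_w f q.
Proof.
rewrite derive1E /derive.
suff -> : (fun h : R => h^-1 *: (((fun t : R => f (q + t *: w)) \o shift 0) (h *: 1)
      - f (q + 0 *: w))) =
    (fun h : R => h^-1 *: ((f \o shift q) (h *: w) - f q)) by [].
by apply/funext => h /=; rewrite addr0 scale0r addr0 [h *: 1]mulr1 [_ + q]addrC.
Qed.

Lemma derive_comp_lin (R : realType) (W W' : normedModType R) (m : {linear W' -> W})
    (f : W -> R) (p v : W') :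
  'D_v (f \o m) p = 'D_(m v) f (m p).
Proof.
rewrite /derive.
suff -> : (fun h : R => h^-1 *: (((f \o m) \o shift p) (h *: v) - (f \o m) p)) =
    (fun h : R => h^-1 *: ((f \o shift (m p)) (h *: m v) - f (m p))) by [].
by apply/funext => h /=; rewrite (linearP m).
Qed.

(* Keeps unification from unfolding derivatives into limits, which is very slow. *)
Local Opaque derive.

Section SmoothDirections.
Context (R : realType) (V : normedModType R) (U : set V).
Hypothesis oU : open U.
Implicit Types f : V -> R.

Lemma smooth_derive_dirD f p v w : smooth_on U f -> U p ->
  'D_(v + w) f p = 'D_v f p + 'D_w f p.
Proof.
by move=> sf Up; have df := smooth_differentiable sf Up; rewrite !deriveE// linearD.
Qed.

Lemma smooth_derive_dirZ f p c v : smooth_on U f -> U p ->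
  'D_(c *: v) f p = c * 'D_v f p.
Proof.
by move=> sf Up; have df := smooth_differentiable sf Up; rewrite !deriveE// linearZ.
Qed.

Lemma smooth_derive_dir_sum (I : finType) f p (c : I -> R) (v : I -> V) :
  smooth_on U f -> U p ->
  'D_(\sum_i c i *: v i) f p = \sum_i c i * 'D_(v i) f p.
Proof.
move=> sf Up; have df := smooth_differentiable sf Up.
rewrite deriveE// linear_sum; apply: eq_bigr => i _.
by rewrite linearZ/= deriveE.
Qed.

Lemma smooth_derive3_comm f p u v w : smooth_on U f -> U p ->
  'D_u ('D_v ('D_w f)) p = 'D_u ('D_w ('D_v f)) p.
Proof.
move=> sf Up; apply: (derive_on_open oU _ Up) => q Uq.
exact: (smooth_derive_comm oU v w sf Uq).
Qed.

(** The rules of this form take the derivatives of the parts as premises, so that long computations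
    can be assembled as proof terms. *)
Lemma smooth_derive_eqM (f g : V -> R) (f' g' : R) p v : smooth_on U f -> smooth_on U g -> U p ->
  'D_v f p = f' -> 'D_v g p = g' ->
  'D_v (fun q => f q * g q) p = f' * g p + f p * g'.
Proof. by move=> sf sg Up <- <-; exact: smooth_deriveM. Qed.

Lemma smooth_derive_eqD (f g : V -> R) (f' g' : R) p v : smooth_on U f -> smooth_on U g -> U p ->
  'D_v f p = f' -> 'D_v g p = g' -> 'D_v (fun q => f q + g q) p = f' + g'.
Proof. by move=> sf sg Up <- <-; exact: smooth_deriveD. Qed.

Lemma smooth_derive_eqZ c f (f' : R) p v : smooth_on U f -> U p ->
  'D_v f p = f' -> 'D_v (fun q => c * f q) p = c * f'.
Proof.
move=> sf Up <-; etransitivity.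
  exact: (smooth_derive_eqM (smooth_cst oU c) sf Up (derive_cst _ _ _) erefl).
by rewrite mul0r add0r.
Qed.

Lemma smooth_derive_eq_sumM (I : finType) (f g : I -> V -> R) (f' g' : I -> R) p v :
  (forall i, smooth_on U (f i)) -> (forall i, smooth_on U (g i)) -> U p ->
  (forall i, 'D_v (f i) p = f' i) -> (forall i, 'D_v (g i) p = g' i) ->
  'D_v (fun q => \sum_i f i q * g i q) p =
  \sum_i f' i * g i p + \sum_i f i p * g' i.
Proof.
move=> sf sg Up f'E g'E; etransitivity.
  by apply: (@smooth_derive_sum _ _ U oU I (fun i q => f i q * g i q)) => // i; exact: smoothM.
rewrite -big_split; apply: eq_bigr => i _.
exact: smooth_derive_eqM.
Qed.

Lemma smooth_sumM (I : finType) (f g : I -> V -> R) :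
  (forall i, smooth_on U (f i)) -> (forall i, smooth_on U (g i)) ->
  smooth_on U (fun q => \sum_i f i q * g i q).
Proof.
by move=> sf sg; apply: (@smooth_sum _ _ U oU I (fun i q => f i q * g i q)) => // i; exact: smoothM.
Qed.

End SmoothDirections.

(* T(v+w,v+w,v+w) and T(v-w,v-w,v-w) give T(v,v,w) = 0. *)
Lemma trilinear_polarization (R : realType) (V : zmodType) (T : V -> V -> V -> R) :
  (forall u u' v w, T (u + u') v w = T u v w + T u' v w) ->
  (forall u v w, T u v w = T v u w) -> (forall u v w, T u v w = T u w v) ->
  (forall v, T v v v = 0) -> forall u v w, T u v w = 0.
Proof.
move=> T1 T12 T23 T0.
have T2 u v v' w : T u (v + v') w = T u v w + T u v' w.
  by rewrite T12 T1 T12 [T v' _ _]T12.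
have T3 u v w w' : T u v (w + w') = T u v w + T u v w'.
  by rewrite T23 T2 T23 [T _ w' _]T23.
have TN u v w : T (- u) v w = - T u v w.
  have T00 : T 0 v w = 0 by have := T1 0 0 v w; rewrite addr0; lra.
  by have := T1 u (- u) v w; rewrite subrr T00; lra.
have T4 v w : T v v w = 0.
  have e1 := T0 (v + w); have e2 := T0 (v + - w).
  have N2 a b c : T a (- b) c = - T a b c by rewrite T12 TN T12.
  have N3 a b c : T a b (- c) = - T a b c by rewrite T23 N2 T23.
  move: e1 e2; rewrite !(T1, T2, T3) !(TN, N2, N3, T0).
  rewrite [T v w v]T23 [T w v v]T12 [T v w v]T23 [T w v w]T12 [T w w v]T23 [T w v w]T12; lra.
move=> u v w; have := T4 (u + v) w; rewrite !(T1, T2) !T4 [T v u w]T12; lra.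
Qed.

(** * Sprays in coordinates *)

Section Spray.
Context (R : realType) (n : nat).
Local Notation E := 'rV[R]_n.
Variable U : set (E * E).
Hypothesis oU : open U.
Implicit Types (f : E * E -> R) (u v : E) (p q : E * E).

Lemma smooth_fiber_coord k : smooth_on U (fun q => q.2 0 k).
Proof.
pose g : E * E -> R := fun q => q.2 0 k.
have lg : linear g by move=> c x z; rewrite /g /= mxE mxE.
pose L := GRing.isLinear.Build R (E * E)%type R _ g lg.
pose g' : {linear (E * E)%type -> R} := HB.pack g L.
apply: (@smooth_lin _ _ U oU g') => q.
apply: (@continuous_comp _ _ _ (@snd E E) (fun z : E => z 0 k)).
  exact: cvg_snd.
exact: coord_continuous.
Qed.

Lemma derive_fiber_coord k p (v : E * E) : 'D_v (fun q : E * E => q.2 0 k) p = v.2 0 k.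
Proof.
pose g : E * E -> R := fun q => q.2 0 k.
have lg : linear g by move=> c x z; rewrite /g /= mxE mxE.
pose L := GRing.isLinear.Build R (E * E)%type R _ g lg.
pose g' : {linear (E * E)%type -> R} := HB.pack g L.
have cg : continuous g'.
  move=> q; apply: (@continuous_comp _ _ _ (@snd E E) (fun z : E => z 0 k)).
    exact: cvg_snd.
  exact: coord_continuous.
rewrite -[LHS]/('D_v g' p) deriveE; last exact: linear_differentiable.
by rewrite diff_lin.
Qed.

Lemma base_dirE u : (u, 0) = \sum_(k < n) u 0 k *: ((delta_mx 0 k : E), (0 : E)).
Proof.
rewrite {1}[u]row_sum_delta; elim/big_rec2: _ => // i y x _ <-.
by rewrite -[RHS]/(u 0 i *: _ + x, u 0 i *: 0 + 0) scaler0 addr0.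
Qed.

Lemma fiber_dirE u : (0, u) = \sum_(k < n) u 0 k *: ((0 : E), (delta_mx 0 k : E)).
Proof.
rewrite {1}[u]row_sum_delta; elim/big_rec2: _ => // i y x _ <-.
by rewrite -[RHS]/(u 0 i *: 0 + 0, u 0 i *: _ + x) scaler0 addr0.
Qed.

Lemma derive_base f p u : smooth_on U f -> U p ->
  'D_(u, 0) f p = \sum_(k < n) u 0 k * dx k f p.
Proof. by move=> sf Up; rewrite base_dirE (smooth_derive_dir_sum _ _ sf Up). Qed.

Lemma derive_fiber f p u : smooth_on U f -> U p ->
  'D_(0, u) f p = \sum_(k < n) u 0 k * dy k f p.
Proof. by move=> sf Up; rewrite fiber_dirE (smooth_derive_dir_sum _ _ sf Up). Qed.

Variable G : 'I_n -> E * E -> R.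
Hypothesis sG : forall i, smooth_on U (G i).

Definition spray_field f q : R :=
  \sum_(k < n) q.2 0 k * dx k f q - 2 * \sum_(i < n) G i q * dy i f q.

Lemma spray_fieldE f q : smooth_on U f -> U q ->
  spray_field f q = 'D_(q.2, - 2 *: \row_i G i q) f q.
Proof.
move=> sf Uq.
have -> : (q.2, - 2 *: (\row_i G i q : E)) = (q.2, 0) + (- 2) *: (0, \row_i G i q).
  by rewrite -[RHS]/(q.2 + _ *: 0, 0 + _) scaler0 addr0 add0r.
rewrite (smooth_derive_dirD _ _ sf Uq) (smooth_derive_dirZ _ _ sf Uq).
rewrite (derive_base _ sf Uq) (derive_fiber _ sf Uq) mulNr /spray_field.
by congr (_ - 2 * _); apply: eq_bigr => i _; rewrite mxE.
Qed.

Lemma smooth_spray_field f : smooth_on U f -> smooth_on U (spray_field f).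
Proof.
move=> sf; apply: smoothB => //.
  apply: smooth_sum => // k; apply: smoothM => //; first exact: smooth_fiber_coord.
  exact: smooth_derive.
apply: smoothM => //; first exact: smooth_cst.
by apply: smooth_sum => // k; apply: smoothM => //; exact: smooth_derive.
Qed.

(** The commutator of a vertical derivative with the spray: differentiating the coefficient [y^k]
    yields the horizontal derivative along [u], differentiating [-2 G^i] yields the last sum. The
    identities along [S] below are obtained by iterating it. *)
Lemma derive_spray_field f u q : smooth_on U f -> U q ->
  'D_(0, u) (spray_field f) q = spray_field ('D_(0, u) f) q + 'D_(u, 0) f q
   - 2 * \sum_(i < n) 'D_(0, u) (G i) q * dy i f q.
Proof.
move=> sf Uq.
have sX k : smooth_on U (dx k f) by exact: smooth_derive.
have sY k : smooth_on U (dy k f) by exact: smooth_derive.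
have A1 := smooth_derive_eq_sumM oU smooth_fiber_coord sX Uq
  (fun k => derive_fiber_coord k q (0, u))
  (fun k => smooth_derive_comm oU (0, u) (delta_mx 0 k, 0) sf Uq).
have A2 := smooth_derive_eq_sumM oU sG sY Uq (fun k => erefl ('D_(0, u) (G k) q))
  (fun k => smooth_derive_comm oU (0, u) (0, delta_mx 0 k) sf Uq).
have s1 := smooth_sumM oU smooth_fiber_coord sX.
have s2 := smooth_sumM oU sG sY.
have A3 := smooth_derive_eqD s1 (smoothM oU (smooth_cst oU (- 2)) s2) Uq A1
  (smooth_derive_eqZ oU (- 2) s2 Uq A2).
etransitivity; last first.
  etransitivity; first exact: A3.
  rewrite (derive_base _ sf Uq).
  have aux (A B C D : R) : A + B + - 2 * (C + D) = B - 2 * D + A - 2 * C by ring.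
  exact: aux.
by apply: (derive_on_open oU _ Uq) => p Up; rewrite mulNr.
Qed.

End Spray.

(** * Homogeneity along the fibres and Euler's identity *)

Section Homogeneity.
Context (R : realType) (n : nat).
Local Notation E := 'rV[R]_n.
Variable U : set (E * E).
Hypothesis oU : open U.
Implicit Types (f : E * E -> R) (u v : E) (p q : E * E).

Definition fiber_homogeneous (k : nat) f := forall (l : R) p,
  0 < l -> U p -> f (p.1, l *: p.2) = l ^+ k * f p.

Definition fiber_scale (l : R) p : E * E := (p.1, l *: p.2).

Lemma fiber_scale_linear l : linear (fiber_scale l).
Proof.
move=> c p q; rewrite /fiber_scale -[RHS]/(c *: p.1 + q.1, c *: (l *: p.2) + l *: q.2).
by rewrite /= scalerDr !scalerA [l * c]mulrC.
Qed.

(** The identity [f \o fiber_scale l = l ^+ k * f] on [U] is differentiated along [v]; the left side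
    is a chain rule with a linear inner map. *)
Lemma derive_fiber_scale k f (l : R) p (v : E * E) :
  fiber_homogeneous k f -> smooth_on U f -> 0 < l -> U p ->
  'D_(fiber_scale l v) f (fiber_scale l p) = l ^+ k * 'D_v f p.
Proof.
move=> hf sf l0 Up.
pose L := GRing.isLinear.Build R (E * E)%type (E * E)%type *:%R _ (fiber_scale_linear l).
pose g : {linear (E * E)%type -> (E * E)%type} := HB.pack (fiber_scale l) L.
rewrite -[LHS](derive_comp_lin g f p v).
etransitivity; last exact: (smooth_derive_eqZ oU (l ^+ k) sf Up erefl).
by apply: (derive_on_open oU _ Up) => q Uq; exact: hf.
Qed.

Lemma fiber_homogeneous_base k f u :
  fiber_homogeneous k f -> smooth_on U f -> fiber_homogeneous k ('D_(u, 0) f).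
Proof.
move=> hf sf l p l0 Up; rewrite -(derive_fiber_scale (u, 0) hf sf l0 Up).
by rewrite /fiber_scale /= scaler0.
Qed.

Hypothesis coneU : forall (l : R) p, 0 < l -> U p -> U (p.1, l *: p.2).

(** [fiber_scale l] multiplies a vertical direction by [l] and fixes a horizontal one, so a vertical
    derivative loses one degree while a horizontal one keeps it. *)
Lemma fiber_homogeneous_fiber k f u :
  fiber_homogeneous k.+1 f -> smooth_on U f -> fiber_homogeneous k ('D_(0, u) f).
Proof.
move=> hf sf l p l0 Up; have ln0 : l != 0 by rewrite gt_eqF.
apply: (mulfI ln0); rewrite mulrA -exprS -(derive_fiber_scale (0, u) hf sf l0 Up).
rewrite -(smooth_derive_dirZ _ _ sf (coneU l0 Up)).
by congr ('D_ _ f _); rewrite -[LHS]/(l *: 0, l *: u) scaler0.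
Qed.

(** Compare the derivatives at 0 of [f (x, (1 + t) y)] and [(1 + t) ^+ k * f (x, y)]; they agree
    only where [1 + t] is positive, hence near 0. *)
Lemma euler_identity k f p : fiber_homogeneous k f -> smooth_on U f -> U p ->
  'D_(0, p.2) f p = k%:R * f p.
Proof.
move=> hf sf Up; set w : E * E := (0, p.2).
have pE : p + (0 : R) *: w = p by rewrite scale0r addr0.
have df : differentiable f (p + (0 : R) *: w).
  by rewrite pE; exact: smooth_differentiable Up.
have d1 := is_derive_line df; rewrite pE in d1.
rewrite -[LHS](@derive_val _ _ _ _ _ _ _ d1).
have d2 : is_derive (0 : R) 1 (fun t : R => (1 + t) ^+ k * f p) (k%:R * f p).
  have d3 : is_derive (0 : R) 1 (cst 1 + @id R) 1 by apply: is_derive_eq; rewrite add0r.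
  have d4 j : is_derive (0 : R) 1 ((cst 1 + @id R) ^+ j) j%:R.
    case: j => [|j]; first by rewrite expr0; exact: is_derive_cst.
    by apply: is_derive_eq; rewrite !fctE addr0 expr1n mulr1 -[_ *: _]/(_ * _) mulr1.
  have -> : (fun t : R => (1 + t) ^+ k * f p) = f p \*: ((cst 1 + @id R) ^+ k).
    by apply/funext => t; rewrite /= exprfctE mulrC.
  by apply: is_derive_eq; rewrite mulrC.
rewrite -[RHS](@derive_val _ _ _ _ _ _ _ d2).
apply: near_eq_derive; near=> t.
have t1 : 0 < 1 + t.
  rewrite -ltrBlDl sub0r; near: t.
  by apply: lt_nbhsr; rewrite ltrN10.
rewrite -(hf _ _ t1 Up); congr f.
by rewrite [p in LHS]surjective_pairing -[LHS]/(p.1 + t *: 0, p.2 + t *: p.2) scaler0 addr0 scalerDl scale1r.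
Unshelve. all: by end_near. Qed.

End Homogeneity.

(** * Higher derivatives along a moving direction *)

Section TrilinearLine.
Context (R : realType) (V : normedModType R) (U : set V).
Hypothesis oU : open U.
Implicit Types (f : V -> R) (p u v w : V).

(** When the direction itself moves with [t], this expansion and the cubic one below transfer [t]
    from the direction to polynomial coefficients, leaving derivatives in fixed directions. *)
Lemma smooth_derive2_line f p v w (t : R) : smooth_on U f -> U p ->
  'D_(v + t *: w) ('D_(v + t *: w) f) p =
  'D_v ('D_v f) p + t * (2 * 'D_w ('D_v f) p) + t ^+ 2 * 'D_w ('D_w f) p.
Proof.
move=> sf Up; pose T u v := 'D_u ('D_v f) p.
have sD a : smooth_on U ('D_a f) by exact: smooth_derive.
have TD u1 u2 v1 : T (u1 + u2) v1 = T u1 v1 + T u2 v1 by apply: smooth_derive_dirD.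
have TZ c u1 v1 : T (c *: u1) v1 = c * T u1 v1 by apply: smooth_derive_dirZ.
have T12 u1 v1 : T u1 v1 = T v1 u1 by exact: (smooth_derive_comm oU _ _ sf Up).
change (T (v + t *: w) (v + t *: w) =
  T v v + t * (2 * T w v) + t ^+ 2 * T w w).
clearbody T.
rewrite TD TZ T12 TD TZ [T w (v + _)]T12 TD TZ [T v w]T12; ring.
Qed.

Lemma smooth_derive3_line f p v w (t : R) : smooth_on U f -> U p ->
  'D_(v + t *: w) ('D_(v + t *: w) ('D_(v + t *: w) f)) p =
  'D_v ('D_v ('D_v f)) p + t * (3 * 'D_w ('D_v ('D_v f)) p)
  + t ^+ 2 * (3 * 'D_w ('D_w ('D_v f)) p) + t ^+ 3 * 'D_w ('D_w ('D_w f)) p.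
Proof.
move=> sf Up; pose T u v w := 'D_u ('D_v ('D_w f)) p.
have sD a b : smooth_on U ('D_a ('D_b f)) by exact/smooth_derive/smooth_derive.
have TD u1 u2 v1 w1 : T (u1 + u2) v1 w1 = T u1 v1 w1 + T u2 v1 w1.
  by apply: smooth_derive_dirD.
have TZ c u1 v1 w1 : T (c *: u1) v1 w1 = c * T u1 v1 w1 by apply: smooth_derive_dirZ.
have T12 u1 v1 w1 : T u1 v1 w1 = T v1 u1 w1.
  by apply: (smooth_derive_comm oU _ _ _ Up); exact: smooth_derive.
have T23 u1 v1 w1 : T u1 v1 w1 = T u1 w1 v1 by exact: (smooth_derive3_comm oU _ _ _ sf Up).
change (T (v + t *: w) (v + t *: w) (v + t *: w) = T v v v + t * (3 * T w v v)
  + t ^+ 2 * (3 * T w w v) + t ^+ 3 * T w w w).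
clearbody T.
pose z := v + t *: w.
have Tz a b : T z a b = T v a b + t * T w a b by rewrite TD TZ.
rewrite -/z Tz [T v z z]T12 [T w z z]T12 !Tz.
rewrite [T v v z]T23 [T w v z]T23 [T v w z]T23 [T w w z]T23.
rewrite [T v z v]T12 [T w z v]T12 [T v z w]T12 [T w z w]T12 !Tz.
rewrite [T v w v]T12 [T v v w]T23 [T v w v]T12 [T w v w]T23 [T v w w]T12 [T w v w]T23; ring.
Qed.

End TrilinearLine.

(** * The first-order condition at a maximum, in one variable *)

Section LocalMaximum.
Context (R : realType).

Lemma derive_at_local_max (f : R -> R) (d : R) : is_derive (0 : R) 1 f d ->
  (\forall t \near (0 : R), f t <= f 0) -> d = 0.
Proof.
move=> df fmax; have dif : differentiable f 0 by apply/derivable1_diffP.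
have [//|dn0] := eqVneq d 0; have d0 : 0 < `|d| / 2 by rewrite divr_gt0// normr_gt0.
have bnd := differentiable_near_bound dif d0.
have [e /= e0 He] := (nbhs_ballP _ _).1 (filterI fmax bnd).
(* A step in the uphill direction: the linear gain is [|d| e / 2] and the error at most half of it,
   so [f t] exceeds [f 0]. *)
pose t := Num.sg d * (e / 2).
have te : ball (0 : R) e t.
  rewrite -ball_normE /= sub0r normrN /t normrM normr_sg dn0 mul1r gtr0_norm ?divr_gt0//.
  by rewrite ltr_pdivrMr// ltr_pMr// ltr1n.
have [ft] := He _ te.
have dt : 'D_t f 0 = t * d.
  by rewrite -[in LHS](mulr1 t) -[t * 1]/(t *: 1) deriveE// linearZ /= -deriveE// derive_val.
have nt : `|t| = e / 2.
  by rewrite /t normrM normr_sg dn0 mul1r gtr0_norm ?divr_gt0.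
have td : t * d = `|d| * (e / 2) by rewrite /t mulrAC -normrEsg.
rewrite add0r dt nt td => /ler_normlP[+ _] => h; move: h ft.
have : 0 < `|d| * e by rewrite mulr_gt0// normr_gt0.
move: (f _) (f 0) => x y; move: `|d| => z; clear; nra.
Qed.

Lemma is_derive_square_cube (A P Q : R -> R) (M A' P' Q' t : R) :
  is_derive t 1 A A' -> is_derive t 1 P P' -> is_derive t 1 Q Q' ->
  is_derive t 1 (fun s => A s * P s ^+ 2 - M * Q s ^+ 3)
    (A' * P t ^+ 2 + 2 * A t * P t * P' - 3 * M * Q t ^+ 2 * Q').
Proof.
move=> dA dP dQ.
have -> : (fun s => A s * P s ^+ 2 - M * Q s ^+ 3) = A * P ^+ 2 - M \*: Q ^+ 3.
  by apply/funext => s; rewrite /= !fctE.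
by apply: is_derive_eq; rewrite !fctE /= -![_ *: _]/(_ * _); ring.
Qed.

Lemma is_derive_mul_id0 (F : R -> R) (d : R) : is_derive (0 : R) 1 F d ->
  is_derive (0 : R) 1 (fun s => s * F s) (F 0).
Proof.
move=> dF; have -> : (fun s => s * F s) = @id R * F by [].
apply: is_derive_eq.
by rewrite scale0r add0r -[_ *: _]/(_ * _) mulr1.
Qed.

(** In Horner form, each factor [s] replaces the derivative at 0 by the value at 0; only [F1 0]
    survives. *)
Lemma is_derive_cubic0 (F0 F1 F2 F3 : R -> R) (d d1 d2 d3 : R) :
  is_derive (0 : R) 1 F0 d -> is_derive (0 : R) 1 F1 d1 ->
  is_derive (0 : R) 1 F2 d2 -> is_derive (0 : R) 1 F3 d3 ->
  is_derive (0 : R) 1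
    (fun s => F0 s + s * F1 s + s ^+ 2 * F2 s + s ^+ 3 * F3 s) (d + F1 0).
Proof.
move=> h0 h1 h2 h3.
have k3 := is_deriveD h2 (is_derive_mul_id0 h3).
have k2 := is_deriveD h1 (is_derive_mul_id0 k3).
have k1 := is_deriveD h0 (is_derive_mul_id0 k2).
have -> : (fun s => F0 s + s * F1 s + s ^+ 2 * F2 s + s ^+ 3 * F3 s) =
    F0 + (fun s => s * (F1 + (fun s => s * (F2 + (fun s => s * F3 s)) s)) s).
  by apply/funext => s; rewrite !fctE; ring.
by move: k1; rewrite !fctE mul0r addr0.
Qed.

(** Let [P] and [Q] be the two polynomial expressions in [t]. The function [A P^2 - M Q^3] is at
    most 0 near 0 and vanishes at 0, so its derivative there is 0. As [A] and [Q] are stationary and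
    [P' = - c P], that derivative is [-2 c A P^2]. *)
Lemma square_cube_maximum (A F0 F1 F2 F3 Q0 Q1 Q2 : R -> R)
    (d d1 d2 d3 e e1 e2 M c : R) :
  is_derive (0 : R) 1 A 0 ->
  is_derive (0 : R) 1 F0 d -> is_derive (0 : R) 1 F1 d1 ->
  is_derive (0 : R) 1 F2 d2 -> is_derive (0 : R) 1 F3 d3 ->
  is_derive (0 : R) 1 Q0 e -> is_derive (0 : R) 1 Q1 e1 ->
  is_derive (0 : R) 1 Q2 e2 ->
  (\forall t \near (0 : R),
    A t * (F0 t + t * F1 t + t ^+ 2 * F2 t + t ^+ 3 * F3 t) ^+ 2 <=
    M * (Q0 t + t * Q1 t + t ^+ 2 * Q2 t) ^+ 3) ->
  A 0 * F0 0 ^+ 2 = M * Q0 0 ^+ 3 ->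
  d + F1 0 = - (c * F0 0) -> e + Q1 0 = 0 -> c != 0 -> 0 < A 0 -> F0 0 = 0.
Proof.
move=> hA h0 h1 h2 h3 k0 k1 k2 hle h00 hd he c0 A0.
(* The quadratic is given a zero cubic coefficient to reuse the cubic lemma. *)
have dQ := is_derive_cubic0 k0 k1 k2 (is_derive_cst (0 : R) (0 : R) 1).
have dpsi := is_derive_square_cube M hA (is_derive_cubic0 h0 h1 h2 h3) dQ.
have psimax : \forall t \near (0 : R),
    A t * (F0 t + t * F1 t + t ^+ 2 * F2 t + t ^+ 3 * F3 t) ^+ 2 -
    M * (Q0 t + t * Q1 t + t ^+ 2 * Q2 t + t ^+ 3 * cst (0 : R) t) ^+ 3 <=
    A 0 * (F0 0 + 0 * F1 0 + 0 ^+ 2 * F2 0 + 0 ^+ 3 * F3 0) ^+ 2 -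
    M * (Q0 0 + 0 * Q1 0 + 0 ^+ 2 * Q2 0 + 0 ^+ 3 * cst (0 : R) (0 : R)) ^+ 3.
  near=> t; have ht := near hle t.
  rewrite !expr0n !mul0r mulr0 !addr0 h00 subrr subr_le0.
  exact: ht.
have := derive_at_local_max dpsi psimax.
rewrite !expr0n !mul0r !addr0 hd he mulr0 subr0 add0r => /eqP.
rewrite mulrN oppr_eq0 !mulf_eq0 (negPf c0) (gt_eqF A0) pnatr_eq0 /=.
by rewrite orbb => /eqP.
Unshelve. all: by end_near. Qed.

End LocalMaximum.

(** * Derivatives of the energy along the geodesic spray *)

Section SprayIdentities.
Context (R : realType) (n : nat).
Local Notation E := 'rV[R]_n.
Variable U : set (E * E).
Hypothesis oU : open U.
Hypothesis coneU : forall (l : R) p, 0 < l -> U p -> U (p.1, l *: p.2).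
Variables (a : E * E -> R) (G : 'I_n -> E * E -> R).
Hypothesis sa : smooth_on U a.
Hypothesis sG : forall i, smooth_on U (G i).
Hypothesis ha : fiber_homogeneous U 2 a.
Local Notation S := (spray_field G).
Hypothesis EL : forall v q, U q -> S ('D_(0, v) a) q = 'D_(v, 0) a q.
Implicit Types (f : E * E -> R) (u v : E) (p q : E * E).

(** Conservation of energy. With [y] and [G] frozen at [q], the Euler-Lagrange equation in the
    direction [y] becomes, by Euler's identity in degrees 2 and 1, [2 'D_(y, 0) a - 2 'D_(0, g) a =
    'D_(y, 0) a], which is the claim. *)
Lemma spray_field_energy q : U q -> S a q = 0.
Proof.
move=> Uq; pose y := q.2; pose g := \row_i G i q.
have := EL y Uq.
rewrite (spray_fieldE _ (smooth_derive _ sa) Uq) -/g.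
rewrite (smooth_derive_comm oU _ _ sa Uq).
have -> : 'D_(0, y) ('D_(q.2, - 2 *: g) a) q = 2 * 'D_(y, 0) a q - 2 * 'D_(0, g) a q.
  have s1 : smooth_on U ('D_(y, 0) a) by exact: smooth_derive.
  have s2 : smooth_on U ('D_(0, g) a) by exact: smooth_derive.
  have h1 := euler_identity (fiber_homogeneous_base oU y ha sa) s1 Uq.
  have h2 := euler_identity (fiber_homogeneous_fiber oU coneU g ha sa) s2 Uq.
  etransitivity; last first.
    etransitivity; first exact: (smooth_derive_eqD s1 (smoothM oU (smooth_cst oU (- 2)) s2)
     Uq h1 (smooth_derive_eqZ oU (- 2) s2 Uq h2)).
    by rewrite mul1r mulNr.
  apply: (derive_on_open oU _ Uq) => p Up.
  rewrite -(smooth_derive_dirZ _ _ sa Up) -(smooth_derive_dirD _ _ sa Up).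
  by congr ('D_ _ a p); rewrite -[RHS]/(y + _ *: 0, 0 + _) scaler0 addr0 add0r.
rewrite (spray_fieldE _ sa Uq) -/g.
have -> : 'D_(q.2, - 2 *: g) a q = 'D_(y, 0) a q - 2 * 'D_(0, g) a q.
  rewrite -mulNr -(smooth_derive_dirZ _ _ sa Uq) -(smooth_derive_dirD _ _ sa Uq).
  by congr ('D_ _ a q); rewrite -[RHS]/(y + _ *: 0, 0 + _) scaler0 addr0 add0r.
by move: ('D_(y, 0) a q) ('D_(0, g) a q) => x z ?; lra.
Qed.

Variable u : E.
Local Notation D f := ('D_((0 : E), u) f).

Let sD f : smooth_on U f -> smooth_on U (D f).
Proof. exact: smooth_derive. Qed.

Let sdy f i : smooth_on U f -> smooth_on U (dy i f).
Proof. exact: smooth_derive. Qed.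

(** Differentiate [S a = 0] vertically: by Euler-Lagrange the first commutator term equals the
    second, and the factor 2 cancels. Geometrically, the horizontal lift of [u] annihilates the
    energy. *)
Lemma energy_horizontal q : U q ->
  'D_(u, 0) a q = \sum_(i < n) D (G i) q * dy i a q.
Proof.
move=> Uq; have := derive_spray_field oU sG u sa Uq.
rewrite (EL u Uq).
have -> : 'D_(0, u) (S a) q = 0.
  etransitivity; last exact: (derive_cst (0 : R) q (0, u)).
  by apply: (derive_on_open oU _ Uq) => p Up; exact: spray_field_energy.
have aux (x z : R) : 0 = z + z - 2 * x -> z = x by lra.
exact: aux.
Qed.

Let deriveGdy f (g : 'I_n -> E * E -> R) q : (forall i, smooth_on U (g i)) -> smooth_on U f -> U q ->
  D (fun q => \sum_(i < n) g i q * dy i f q) q =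
  \sum_(i < n) D (g i) q * dy i f q + \sum_(i < n) g i q * dy i (D f) q.
Proof.
move=> sg sf Uq.
exact: (smooth_derive_eq_sumM oU sg (fun i => sdy i sf) Uq (fun k => erefl (D (g k) q))
  (fun k => smooth_derive_comm oU (0, u) (0, delta_mx 0 k) sf Uq)).
Qed.

(** Differentiate the Euler-Lagrange equation once along [u]; the mixed derivative of [a] appears on
    both sides and cancels. This is the parallelism of the fundamental tensor along geodesics. *)
Lemma spray_field_second q : U q ->
  S (D (D a)) q = 2 * \sum_(i < n) D (G i) q * dy i (D a) q.
Proof.
move=> Uq; have := derive_spray_field oU sG u (sD sa) Uq.
have -> : 'D_(0, u) (S (D a)) q = 'D_(u, 0) (D a) q.
  rewrite -(smooth_derive_comm oU (0, u) (u, 0) sa Uq).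
  by apply: (derive_on_open oU _ Uq) => p Up; exact: EL.
have aux (x y z : R) : y = z + y - 2 * x -> z = 2 * x by lra.
exact: aux.
Qed.

(** Differentiate [spray_field_second] once and [energy_horizontal] twice, then eliminate the
    horizontal derivative of [D (D a)]: the terms with two derivatives of [G] cancel. The last sum
    is, up to a constant, the Landsberg curvature. *)
Lemma spray_field_third q : U q ->
  S (D (D (D a))) q = 3 * \sum_(i < n) D (G i) q * dy i (D (D a)) q
    - \sum_(i < n) D (D (D (G i))) q * dy i a q.
Proof.
have aux (A B C z L X : R) : L = z + X - 2 * C -> L = 2 * (B + C) ->
  X = A + B + (B + C) -> z = 3 * C - A by lra.
move=> Uq; have H := derive_spray_field oU sG u (sD (sD sa)) Uq.
have sDG i : smooth_on U (D (G i)) by exact: sD.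
have sDDG i : smooth_on U (D (D (G i))) by exact: sD.
have E1 : 'D_(0, u) (S (D (D a))) q =
   2 * (\sum_(i < n) D (D (G i)) q * dy i (D a) q +
        \sum_(i < n) D (G i) q * dy i (D (D a)) q).
  etransitivity; last first.
    exact: (smooth_derive_eqZ oU 2 (smooth_sumM oU sDG (fun i => sdy i (sD sa))) Uq
            (deriveGdy sDG (sD sa) Uq)).
  by apply: (derive_on_open oU _ Uq) => p Up; exact: spray_field_second.
have X1 p : U p -> 'D_(u, 0) (D a) p =
   \sum_(i < n) D (D (G i)) p * dy i a p + \sum_(i < n) D (G i) p * dy i (D a) p.
  move=> Up; etransitivity; first exact: (esym (smooth_derive_comm oU (0, u) (u, 0) sa Up)).
  etransitivity; last exact: (deriveGdy sDG sa Up).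
  by apply: (derive_on_open oU _ Up) => p' Up'; exact: energy_horizontal.
have E2 : 'D_(u, 0) (D (D a)) q =
   \sum_(i < n) D (D (D (G i))) q * dy i a q + \sum_(i < n) D (D (G i)) q * dy i (D a) q
   + (\sum_(i < n) D (D (G i)) q * dy i (D a) q + \sum_(i < n) D (G i) q * dy i (D (D a)) q).
  etransitivity; first exact: (esym (smooth_derive_comm oU (0, u) (u, 0) (sD sa) Uq)).
  etransitivity; last first.
    exact: (smooth_derive_eqD (smooth_sumM oU sDDG (fun i => sdy i sa))
       (smooth_sumM oU sDG (fun i => sdy i (sD sa))) Uq
       (deriveGdy sDDG sa Uq) (deriveGdy sDG (sD sa) Uq)).
  by apply: (derive_on_open oU _ Uq) => p Up; exact: X1.
exact: (aux _ _ _ _ _ _ H E1 E2).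
Qed.

End SprayIdentities.

(** * The spray at a maximum, and under vanishing torsion *)

Section SprayMaximum.
Context (R : realType) (n : nat).
Local Notation E := 'rV[R]_n.
Variable U : set (E * E).
Hypothesis oU : open U.
Hypothesis coneU : forall (l : R) p, 0 < l -> U p -> U (p.1, l *: p.2).
Variables (a : E * E -> R) (G : 'I_n -> E * E -> R).
Hypothesis sa : smooth_on U a.
Hypothesis sG : forall i, smooth_on U (G i).
Hypothesis ha : fiber_homogeneous U 2 a.
Local Notation S := (spray_field G).
Hypothesis EL : forall (v : E) q, U q -> S ('D_(0, v) a) q = 'D_(v, 0) a q.
Implicit Types (f : E * E -> R) (u v : E) (p q : E * E).

Lemma is_derive_spray_line f q : smooth_on U f -> U q ->
  is_derive (0 : R) 1 (fun t : R => f (q + t *: (q.2, - 2 *: \row_i G i q))) (S f q).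
Proof.
move=> sf Uq; set w := (q.2, _).
have q0 : q + (0 : R) *: w = q by rewrite scale0r addr0.
have df : differentiable f (q + (0 : R) *: w).
  by rewrite q0; exact: smooth_differentiable Uq.
have := is_derive_line df.
by rewrite q0 (spray_fieldE _ sf Uq).
Qed.

(* Along [t |-> (q + t (y, -2 G), u - t N u)] the second derivative
   [D_u D_u a] and [a] are constant to first order, while [D_u D_u D_u a] has
   logarithmic derivative [- c]. *)
Lemma cubic_zero_at_max q u (c M : R) : U q -> c != 0 -> 0 < a q ->
  \sum_(i < n) 'D_(0, u) ('D_(0, u) ('D_(0, u) (G i))) q * dy i a q =
    c * 'D_(0, u) ('D_(0, u) ('D_(0, u) a)) q ->
  (forall p v, U p -> a p * 'D_(0, v) ('D_(0, v) ('D_(0, v) a)) p ^+ 2 <=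
     M * 'D_(0, v) ('D_(0, v) a) p ^+ 3) ->
  a q * 'D_(0, u) ('D_(0, u) ('D_(0, u) a)) q ^+ 2 =
     M * 'D_(0, u) ('D_(0, u) a) q ^+ 3 ->
  'D_(0, u) ('D_(0, u) ('D_(0, u) a)) q = 0.
Proof.
move=> Uq c0 aq iso maxh eqh.
pose w : E * E := (q.2, - 2 *: \row_i G i q).
(* The velocity [- N u] of the direction; it is chosen to cancel the sums with coefficients 2 and 3
   in [spray_field_second] and [spray_field_third]. *)
pose W : E * E := (0, - \row_i 'D_(0, u) (G i) q).
pose z : E * E := (0, u).
have sD f (v : E * E) : smooth_on U f -> smooth_on U ('D_v f) by exact: smooth_derive.
have dW f : smooth_on U f ->
    'D_W f q = - \sum_(i < n) 'D_z (G i) q * dy i f q.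
  move=> sf; have := derive_fiber (- \row_i 'D_(0, u) (G i) q) sf Uq.
  rewrite -sumrN => ->; apply: eq_bigr => i _.
  by rewrite !mxE mulNr.
have dl f : smooth_on U f ->
  is_derive (0 : R) 1 (fun t : R => f (q + t *: w)) (S f q).
  by move=> sf; exact: is_derive_spray_line.
have dlZ (k : R) f : smooth_on U f ->
    is_derive (0 : R) 1 (fun t : R => k * f (q + t *: w)) (k * S f q).
  by move=> sf; exact: (is_deriveZ k (dl _ sf)).
have sa1 (b : E * E) := sD _ b sa.
have sa2 (b b' : E * E) := sD _ b' (sa1 b).
have sa3 (b b' b'' : E * E) := sD _ b'' (sa2 b b').
have aux (b x X y Y : R) : x = X -> y = Y -> b * x ^+ 2 <= M * y ^+ 3 ->
  b * X ^+ 2 <= M * Y ^+ 3 by move=> -> ->.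
have aux2 (r x y d g : R) : r = 3 * x - d -> y = - x -> d = c * g ->
  r + 3 * y = - (c * g).
  by move=> -> -> ->; rewrite mulrN addrAC subrr add0r.
have maxh' p (b : E * E) : U p -> b.1 = 0 ->
   a p * 'D_b ('D_b ('D_b a)) p ^+ 2 <= M * 'D_b ('D_b a) p ^+ 3.
  by case: b => b1 b2 Up /= ->; exact: maxh.
have q0 : q + (0 : R) *: w = q by rewrite scale0r addr0.
have Un : \forall t \near (0 : R), U (q + t *: w).
  have cl : continuous (fun t : R => q + t *: w).
    move=> t; apply: cvgD; first exact: cvg_cst.
    by apply: cvgZl; exact: cvg_id.
  have := cl 0; rewrite /continuous_at q0; apply.
  exact: open_nbhs_nbhs (conj oU Uq).
have dA := dl _ sa; rewrite (spray_field_energy oU coneU sa ha EL Uq) in dA.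
(* The coefficients are those of the third and second derivatives of [a] along [z + t *: W]; the
   factors 3 and 2 are binomial. *)
have key := square_cube_maximum dA (dl _ (sa3 z z z)) (dlZ 3 _ (sa3 z z W))
  (dlZ 3 _ (sa3 z W W)) (dl _ (sa3 W W W)) (dl _ (sa2 z z)) (dlZ 2 _ (sa2 z W))
  (dl _ (sa2 W W)).
move: (key M c); rewrite /= q0; apply => //.
- apply: filterS Un => t Ut.
  have e3 := smooth_derive3_line oU z W t sa Ut.
  have e2 := smooth_derive2_line oU z W t sa Ut.
  have zW : (z + t *: W).1 = 0 by rewrite -[LHS]/(0 + t *: 0) scaler0 addr0.
  exact: (aux _ _ _ _ _ e3 e2 (maxh' _ _ Ut zW)).
- exact: (aux2 _ _ _ _ _ (spray_field_third oU coneU sa sG ha EL u Uq) (dW _ (sa2 z z)) iso).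
- rewrite (spray_field_second oU sa sG EL u Uq) (dW _ (sa1 z)).
  by rewrite mulrN subrr.
Qed.

Section VanishingThirdDerivative.
Hypothesis a3 : forall (u v w : E) q, U q -> 'D_(0, u) ('D_(0, v) ('D_(0, w) a)) q = 0.

(** Differentiate the Euler-Lagrange equation for [v] three times along [u]. The horizontal side
    becomes a horizontal derivative of a vanishing third derivative of [a], and among the commutator
    terms only the one with three derivatives on [G] avoids such a factor. So the third derivative
    of [G] is orthogonal to every [v] for the Hessian of [a]. *)
Lemma spray_third_derivative_orthogonal u v q : U q ->
  \sum_(i < n) 'D_(0, u) ('D_(0, u) ('D_(0, u) (G i))) q * dy i ('D_(0, v) a) q = 0.
Proof.
pose z : E * E := (0, u); pose z' : E * E := (u, 0); pose f := 'D_((0 : E), v) a.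
have sD (g : E * E -> R) (b : E * E) : smooth_on U g -> smooth_on U ('D_b g) by exact: smooth_derive.
have sf : smooth_on U f by exact: sD.
have sf' : smooth_on U ('D_z f) by exact: sD.
have D0 (g : E * E -> R) (b : E * E) p :
    (forall p, U p -> g p = 0) -> U p -> 'D_b g p = 0.
  move=> g0 Up; etransitivity; last exact: (derive_cst (0 : R) p b).
  exact: (derive_on_open oU b Up g0).
have S0 (g : E * E -> R) p : (forall p, U p -> g p = 0) -> U p -> S g p = 0.
  move=> g0 Up.
  have d1 : \sum_(k < n) p.2 0 k * dx k g p = 0.
    by apply: big1 => k _; apply/eqP; rewrite mulf_eq0; apply/orP; right; apply/eqP; exact: D0.
  have d2 : \sum_(k < n) G k p * dy k g p = 0.
    by apply: big1 => k _; apply/eqP; rewrite mulf_eq0; apply/orP; right; apply/eqP; exact: D0.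
  have aux (x y : R) : x = 0 -> y = 0 -> x - 2 * y = 0.
    by move=> -> ->; rewrite mulr0 subr0.
  exact: (aux _ _ d1 d2).
have f2 p : U p -> 'D_z ('D_z f) p = 0 by exact: a3.
have N0 (g : 'I_n -> E * E -> R) p : U p -> \sum_(i < n) g i p * dy i ('D_z f) p = 0.
  by move=> Up; apply: big1 => i _; rewrite [dy _ _ _](a3 _ _ _ Up) mulr0.
have sG1 i : smooth_on U ('D_z (G i)) by exact: sD.
have sG2 i : smooth_on U ('D_z ('D_z (G i))) by exact: sD.
have sY i : smooth_on U (dy i f) by exact: sD.
have DN (g : 'I_n -> E * E -> R) p : (forall i, smooth_on U (g i)) -> U p ->
    'D_z (fun p => \sum_(i < n) g i p * dy i f p) p =
    \sum_(i < n) 'D_z (g i) p * dy i f p.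
  move=> sg Up; etransitivity.
    exact: (smooth_derive_eq_sumM oU sg sY Up (fun k => erefl ('D_z (g k) p))
      (fun k => smooth_derive_comm oU z (0, delta_mx 0 k) sf Up)).
  by rewrite [X in _ + X](N0 g p Up) addr0.
have E1 p : U p -> 'D_z ('D_(v, 0) a) p =
    S ('D_z f) p + 'D_z' f p - 2 * \sum_(i < n) 'D_z (G i) p * dy i f p.
  move=> Up; rewrite -(derive_spray_field oU sG u sf Up).
  by apply: (derive_on_open oU z Up) => p' Up'; rewrite [RHS]EL.
have E2 p : U p -> 'D_z ('D_z ('D_(v, 0) a)) p =
    2 * 'D_z' ('D_z f) p - 2 * \sum_(i < n) 'D_z ('D_z (G i)) p * dy i f p.
  move=> Up.
  have h1 : 'D_z (S ('D_z f)) p = 'D_z' ('D_z f) p.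
    have aux (x y d r : R) : r = x + y - 2 * d -> x = 0 -> d = 0 -> r = y.
      by move=> -> -> ->; rewrite add0r mulr0 subr0.
    exact: (aux _ _ _ _ (derive_spray_field oU sG u sf' Up) (S0 _ _ f2 Up)
      (N0 (fun i => 'D_z (G i)) p Up)).
  have h2 := smooth_derive_comm oU z z' sf Up.
  have h3 := smooth_derive_eqZ oU (- 2) (smooth_sumM oU sG1 sY) Up (DN _ _ sG1 Up).
  have sS := smooth_spray_field oU sG sf'.
  have sz' : smooth_on U ('D_z' f) by exact: sD.
  have h4 := smooth_derive_eqD (smoothD oU sS sz')
    (smoothM oU (smooth_cst oU (- 2)) (smooth_sumM oU sG1 sY)) Up
    (smooth_derive_eqD sS sz' Up h1 h2) h3.
  etransitivity; last first.
    by etransitivity; [exact: h4|rewrite mulNr -mulr2n mulr_natl].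
  by apply: (derive_on_open oU z Up) => p' Up'; rewrite mulNr; exact: E1.
move=> Uq.
have h1 : 'D_z ('D_z' ('D_z f)) q = 0.
  etransitivity; first exact: (smooth_derive_comm oU z z' sf' Uq).
  exact: (D0 _ z' q f2 Uq).
pose x : E * E := (v, 0).
have sz1 : smooth_on U ('D_z a) by exact: sD.
have sz2 : smooth_on U ('D_z ('D_z a)) by exact: sD.
have C1 p : U p -> 'D_z ('D_x a) p = 'D_x ('D_z a) p.
  exact: (smooth_derive_comm oU z x sa).
have C2 p : U p -> 'D_z ('D_z ('D_x a)) p = 'D_x ('D_z ('D_z a)) p.
  move=> Up; etransitivity; first exact: (derive_on_open oU z Up C1).
  exact: (smooth_derive_comm oU z x sz1 Up).
have h2 : 'D_z ('D_z ('D_z ('D_x a))) q = 0.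
  etransitivity; first exact: (derive_on_open oU z Uq C2).
  etransitivity; first exact: (smooth_derive_comm oU z x sz2 Uq).
  exact: (D0 _ x q (fun p Up => a3 u u u Up) Uq).
have sf'z' := sD _ z' sf'.
have h3 := smooth_derive_eqD (smoothM oU (smooth_cst oU 2) sf'z')
  (smoothM oU (smooth_cst oU (- 2)) (smooth_sumM oU sG2 sY)) Uq
  (smooth_derive_eqZ oU 2 sf'z' Uq h1)
  (smooth_derive_eqZ oU (- 2) (smooth_sumM oU sG2 sY) Uq (DN _ _ sG2 Uq)).
have h4 : 'D_z ('D_z ('D_z ('D_x a))) q =
    2 * 0 + (- 2) * \sum_(i < n) 'D_z ('D_z ('D_z (G i))) q * dy i f q.
  etransitivity; last exact: h3.
  by apply: (derive_on_open oU z Uq) => p Up; rewrite mulNr; exact: E2.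
have aux (y d : R) : d = 2 * 0 + (- 2) * y -> d = 0 -> y = 0.
  move=> -> /eqP; rewrite mulr0 add0r mulf_eq0 oppr_eq0 pnatr_eq0 /= => /eqP //.
exact: (aux _ _ h4 h2).
Qed.

End VanishingThirdDerivative.

End SprayMaximum.

(** * The spray of an energy with positive definite fibre Hessian *)

Section LocalSpray.
Context (R : realType) (n : nat).
Local Notation E := 'rV[R]_n.
Variable U : set (E * E).
Hypothesis oU : open U.
Implicit Types (f : E * E -> R) (u v : E) (p q : E * E).

Lemma derive2_fiber f q u : smooth_on U f -> U q ->
  'D_(0, u) ('D_(0, u) f) q =
  \sum_(k < n) u 0 k * \sum_(j < n) u 0 j * dy j (dy k f) q.
Proof.
move=> sf Uq; rewrite (derive_fiber _ (smooth_derive _ sf) Uq).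
apply: eq_bigr => k _; congr (_ * _); rewrite -(derive_fiber _ (smooth_derive _ sf) Uq).
exact: (smooth_derive_comm oU (0, delta_mx 0 k) (0, u) sf Uq).
Qed.

(** As a polynomial in [u] with smooth coefficients, the left side is visibly continuous jointly in
    point and direction; the coefficients for [G] are the Berwald components. *)
Lemma derive3_fiber f q u : smooth_on U f -> U q ->
  'D_(0, u) ('D_(0, u) ('D_(0, u) f)) q =
  \sum_(l < n) u 0 l * \sum_(k < n) u 0 k * \sum_(j < n) u 0 j * dy j (dy k (dy l f)) q.
Proof.
move=> sf Uq; have sDf := smooth_derive (0, u) sf.
rewrite (derive_fiber _ (smooth_derive _ sDf) Uq).
apply: eq_bigr => l _; congr (_ * _).
rewrite -(derive2_fiber u (smooth_derive _ sf) Uq).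
etransitivity; first exact: (smooth_derive_comm oU (0, delta_mx 0 l) (0, u) sDf Uq).
apply: (derive_on_open oU (0, u) Uq) => p Up.
exact: (smooth_derive_comm oU (0, delta_mx 0 l) (0, u) sf Up).
Qed.

Lemma smooth_det m (A : 'I_m -> 'I_m -> E * E -> R) :
  (forall i j, smooth_on U (A i j)) ->
  smooth_on U (fun q => \det (\matrix_(i, j) A i j q)).
Proof.
move=> sA; apply: (@smooth_ext _ _ U oU (fun q =>
   \sum_(s : 'S_m) (-1) ^+ s * \prod_i A i (s i) q)).
  by move=> q _; apply: eq_bigr => s _; congr (_ * _); apply: eq_bigr => i _; rewrite mxE.
apply: (smooth_sumM oU) => s; first exact: smooth_cst.
exact: smooth_prod.
Qed.

(** Cramer's rule. The minors are indexed through [lift], which needs a successor size; in size 0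
    there is no index. *)
Lemma smooth_invmx m (A : 'I_m -> 'I_m -> E * E -> R) i j :
  (forall i j, smooth_on U (A i j)) ->
  (forall q, U q -> \matrix_(i, j) A i j q \in unitmx) ->
  smooth_on U (fun q => invmx (\matrix_(i, j) A i j q) i j).
Proof.
case: m A i j => [|m] A i j sA uA; first by case: i.
apply: (@smooth_ext _ _ U oU (fun q => (\det (\matrix_(i, j) A i j q))^-1 *
   ((-1) ^+ (j + i) * \det (\matrix_(k, l) A (lift j k) (lift i l) q)))).
  move=> q Uq; rewrite /invmx uA// !mxE; congr (_ * (_ * \det _)).
  by apply/matrixP => k l; rewrite !mxE.
apply: (smoothM oU).
  apply: (smoothV oU); last exact: smooth_det.
  by move=> q Uq; have := uA q Uq; rewrite unitmxE unitfE.
apply: (smoothM oU); first exact: smooth_cst.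
by apply: smooth_det => k l.
Qed.

Variable a : E * E -> R.
Hypothesis sa : smooth_on U a.
Hypothesis posa : forall (w : E) q, U q -> w != 0 -> 0 < 'D_(0, w) ('D_(0, w) a) q.

Definition half_hessian q : 'M[R]_n := \matrix_(j, k) (2^-1 * dy j (dy k a) q).

(** The formula of [spray] with the half Hessian of [a] in place of [fund_mx], so that it depends on
    the function [a] alone; [sprayE] identifies the two on the slit domain. *)
Definition local_spray (b : 'I_n) q : R :=
  4^-1 * \sum_(m < n) invmx (half_hessian q) b m *
    (\sum_(k < n) dx k (dy m a) q * q.2 0 k - dx m a q).

(** A nonzero vector [w] of the left kernel would make the second derivative of [a] along [w]
    vanish. *)
Lemma half_hessian_unit q : U q -> half_hessian q \in unitmx.
Proof.
move=> Uq; rewrite -row_free_unit -kermx_eq0; apply/eqP/row_matrixP => i.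
rewrite row0; set w := row i _; apply/eqP/negPn/negP => w0.
have wk : w *m half_hessian q = 0 by apply/sub_kermxP; exact: row_sub.
clearbody w.
have := posa Uq w0; rewrite derive2_fiber//.
suff -> : \sum_(k < n) w 0 k * \sum_(j < n) w 0 j * dy j (dy k a) q = 0 by rewrite ltxx.
apply: big1 => k _; move/rowP/(_ k): wk; rewrite !mxE => wk.
have -> : \sum_(j < n) w 0 j * dy j (dy k a) q = 2 * \sum_j w 0 j * half_hessian q j k.
  rewrite mulr_sumr; apply: eq_bigr => j _; rewrite mxE.
  have aux (x y : R) : x * y = 2 * (x * (2^-1 * y)) by field.
  exact: aux.
by rewrite wk !mulr0.
Qed.

Lemma smooth_local_spray b : smooth_on U (local_spray b).
Proof.
apply: (smoothM oU); first exact: smooth_cst.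
have sdd j k : smooth_on U (dy j (dy k a)) by exact/smooth_derive/smooth_derive.
apply: (smooth_sumM oU) => m.
  apply: (smooth_invmx b m); last exact: half_hessian_unit.
  by move=> j k; apply: (smoothM oU) => //; exact: smooth_cst.
apply: (smoothB oU); last exact: smooth_derive.
apply: (smooth_sumM oU) => k; last exact: smooth_fiber_coord.
exact/smooth_derive/smooth_derive.
Qed.

(** By construction [local_spray] solves the linear system with matrix [half_hessian]; multiplying
    back gives the equation in coordinate directions, and linearity gives it for [v]. *)
Lemma euler_lagrange v q : U q ->
  spray_field local_spray ('D_(0, v) a) q = 'D_(v, 0) a q.
Proof.
move=> Uq; have sdy (m : 'I_n) : smooth_on U (dy m a) by exact: smooth_derive.
have ELm m : spray_field local_spray (dy m a) q = dx m a q.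
  pose r m := \sum_(k < n) dx k (dy m a) q * q.2 0 k - dx m a q.
  have GE : half_hessian q *m (\col_i local_spray i q) = 4^-1 *: \col_i r i.
    have -> : \col_i local_spray i q = 4^-1 *: (invmx (half_hessian q) *m \col_i r i).
      apply/colP => i; rewrite !mxE; congr (_ * _); apply: eq_bigr => j _.
      by rewrite mxE.
    by rewrite -scalemxAr mulKVmx//; exact: half_hessian_unit.
  move/colP/(_ m): GE; rewrite !mxE => GE.
  have e1 : \sum_(i < n) local_spray i q * dy i (dy m a) q = 2 * (4^-1 * r m).
    rewrite -GE mulr_sumr; apply: eq_bigr => i _; rewrite !mxE.
    have e : dy i (dy m a) q = dy m (dy i a) q.
      exact: (smooth_derive_comm oU (0, delta_mx 0 i) (0, delta_mx 0 m) sa Uq).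
    have aux (x y : R) : x * y = 2 * (2^-1 * y * x) by field.
    by rewrite e; exact: aux.
  have e2 : \sum_(k < n) q.2 0 k * dx k (dy m a) q = r m + dx m a q.
    by rewrite subrK; apply: eq_bigr => k _; exact: mulrC.
  have aux (A B c d : R) : A = c + d -> B = 2 * (4^-1 * c) -> A - 2 * B = d.
    by move=> -> ->; field.
  exact: (aux _ _ _ _ e2 e1).
rewrite (spray_fieldE _ (smooth_derive _ sa) Uq); set w := (q.2, _).
rewrite (smooth_derive_comm oU w (0, v) sa Uq).
rewrite (derive_fiber _ (smooth_derive w sa) Uq) (derive_base _ sa Uq).
apply: eq_bigr => m _; congr (_ * _); rewrite -ELm.
rewrite (spray_fieldE _ (sdy m) Uq).
exact: (smooth_derive_comm oU (0, delta_mx 0 m) w sa Uq).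
Qed.

Lemma continuous_sumM m (f g : 'I_m -> E * E * E -> R) z :
  (forall k, {for z, continuous (f k)}) -> (forall k, {for z, continuous (g k)}) ->
  {for z, continuous (fun z => \sum_(k < m) f k z * g k z)}.
Proof.
move=> cf cg; rewrite unlock; elim: (index_enum _) => [|k s IH] /=; first exact: cvg_cst.
by apply: continuousD => //; apply: continuousM.
Qed.

Lemma continuous_dir_coord (k : 'I_n) (z : E * E * E) :
  {for z, continuous (fun z : E * E * E => z.2 0 k)}.
Proof.
apply: (@continuous_comp _ _ _ (@snd (E * E) E) (fun x : E => x 0 k)).
  exact: cvg_snd.
exact: coord_continuous.
Qed.

Lemma continuous_smooth_fst f (z : E * E * E) : smooth_on U f -> U z.1 ->
  {for z, continuous (fun z => f z.1)}.
Proof.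
move=> sf Uz; apply: (@continuous_comp _ _ _ (@fst (E * E) E) f).
  exact: cvg_fst.
exact: smooth_continuous.
Qed.

Lemma continuous_near_eq (f g : E * E * E -> R) (z : E * E * E) : U z.1 ->
  (forall z, U z.1 -> f z = g z) -> {for z, continuous g} -> {for z, continuous f}.
Proof.
move=> Uz fg cg; rewrite /prop_for /continuous_at (fg z Uz).
apply: cvg_trans cg; apply: near_eq_cvg.
have Un : \forall z' \near z, U z'.1.
  have cf : {for z, continuous (@fst (E * E)%type E)} by exact: cvg_fst.
  exact: (cf U (open_nbhs_nbhs (conj oU Uz))).
by apply: filterS Un => z' Uz'; rewrite fg.
Qed.

Lemma continuous_derive2_fiber f (z : E * E * E) : smooth_on U f -> U z.1 ->
  {for z, continuous (fun z : E * E * E => 'D_(0, z.2) ('D_(0, z.2) f) z.1)}.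
Proof.
move=> sf Uz; apply: (continuous_near_eq Uz (fun z' Uz' => derive2_fiber z'.2 sf Uz')).
apply: (@continuous_sumM n (fun k z => z.2 0 k)) => k.
  exact: continuous_dir_coord.
apply: (@continuous_sumM n (fun k z => z.2 0 k)) => j.
  exact: continuous_dir_coord.
by apply: continuous_smooth_fst Uz; exact/smooth_derive/smooth_derive.
Qed.

Lemma continuous_derive3_fiber f (z : E * E * E) : smooth_on U f -> U z.1 ->
  {for z, continuous
    (fun z : E * E * E => 'D_(0, z.2) ('D_(0, z.2) ('D_(0, z.2) f)) z.1)}.
Proof.
move=> sf Uz; apply: (continuous_near_eq Uz (fun z' Uz' => derive3_fiber z'.2 sf Uz')).
apply: (@continuous_sumM n (fun k z => z.2 0 k)) => l.
  exact: continuous_dir_coord.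
apply: (@continuous_sumM n (fun k z => z.2 0 k)) => k.
  exact: continuous_dir_coord.
apply: (@continuous_sumM n (fun k z => z.2 0 k)) => j.
  exact: continuous_dir_coord.
by apply: continuous_smooth_fst Uz; exact/smooth_derive/smooth_derive/smooth_derive.
Qed.

(* Homogeneous of degree 0 in [z.1.2] and in [z.2]. *)
Definition cubic_ratio (z : E * E * E) : R :=
  a z.1 * 'D_(0, z.2) ('D_(0, z.2) ('D_(0, z.2) a)) z.1 ^+ 2
  / 'D_(0, z.2) ('D_(0, z.2) a) z.1 ^+ 3.

Lemma continuous_cubic_ratio (z : E * E * E) : U z.1 -> z.2 != 0 ->
  {for z, continuous cubic_ratio}.
Proof.
move=> Uz z0; have Q0 := posa Uz z0.
apply: continuousM.
  apply: continuousM; first exact: continuous_smooth_fst.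
  apply: continuousM; exact: continuous_derive3_fiber.
apply: continuousV; first by rewrite expf_neq0// gt_eqF.
have c2 := continuous_derive2_fiber sa Uz.
by apply: continuousM => //; apply: continuousM.
Qed.

Hypothesis coneU : forall (l : R) p, 0 < l -> U p -> U (p.1, l *: p.2).
Hypothesis ha : fiber_homogeneous U 2 a.

Lemma cubic_ratio_scale_base (l : R) (z : E * E * E) : 0 < l -> U z.1 ->
  cubic_ratio (z.1.1, l *: z.1.2, z.2) = cubic_ratio z.
Proof.
move=> l0 Uz; have ln0 : l != 0 by rewrite gt_eqF.
set u := z.2; set p := z.1.
have h1 := fiber_homogeneous_fiber oU coneU u ha sa.
have s1 : smooth_on U ('D_(0, u) a) by exact: smooth_derive.
have s2 : smooth_on U ('D_(0, u) ('D_(0, u) a)) by exact: smooth_derive.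
have h2 := fiber_homogeneous_fiber oU coneU u h1 s1.
have e0 := ha l0 Uz.
have e2 := h2 _ _ l0 Uz.
(* The third derivative has degree -1, outside the natural degrees of [fiber_homogeneous], so the
   factor [l] is kept on the left. *)
have e3 : l * 'D_(0, u) ('D_(0, u) ('D_(0, u) a)) (fiber_scale l p) =
    'D_(0, u) ('D_(0, u) ('D_(0, u) a)) p.
  rewrite -[RHS]mul1r -(expr0 l) -(derive_fiber_scale oU (0, u) h2 s2 l0 Uz).
  rewrite -(smooth_derive_dirZ _ _ s2 (coneU l0 Uz)).
  by congr ('D_ _ _ _); rewrite -[LHS]/(l *: 0, l *: u) scaler0.
have aux (x y t t' r r' : R) : x = l ^+ 2 * y -> r = l ^+ 0 * r' -> l * t = t' ->
    x * t ^+ 2 / r ^+ 3 = y * t' ^+ 2 / r' ^+ 3.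
  by move=> -> -> <-; rewrite expr0 mul1r; ring.
exact: (aux _ _ _ _ _ _ e0 e2 e3).
Qed.

Lemma cubic_ratio_scale_dir (l : R) (z : E * E * E) : 0 < l -> U z.1 -> z.2 != 0 ->
  cubic_ratio (z.1, l *: z.2) = cubic_ratio z.
Proof.
move=> l0 Uz z0; have ln0 : l != 0 by rewrite gt_eqF.
set u := z.2; set p := z.1.
pose w : E * E := (0, u).
have wl : (0, l *: u) = l *: w by rewrite -[RHS]/(l *: 0, l *: u) scaler0.
have s1 : smooth_on U ('D_w a) by exact: smooth_derive.
have s2 : smooth_on U ('D_w ('D_w a)) by exact: smooth_derive.
have E1 q : U q -> 'D_(l *: w) a q = l * 'D_w a q.
  by move=> Uq; exact: (smooth_derive_dirZ _ _ sa Uq).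
have E2 q : U q -> 'D_(l *: w) ('D_(l *: w) a) q = l ^+ 2 * 'D_w ('D_w a) q.
  move=> Uq; etransitivity; first exact: (derive_on_open oU _ Uq E1).
  etransitivity; first exact: (smooth_derive_eqZ oU l s1 Uq (smooth_derive_dirZ _ _ s1 Uq)).
  by rewrite expr2 mulrA.
have E3 : 'D_(l *: w) ('D_(l *: w) ('D_(l *: w) a)) p = l ^+ 3 * 'D_w ('D_w ('D_w a)) p.
  etransitivity; first exact: (derive_on_open oU _ Uz E2).
  etransitivity; first exact: (smooth_derive_eqZ oU _ s2 Uz (smooth_derive_dirZ _ _ s2 Uz)).
  by rewrite mulrA -exprSr.
have aux (x t t' r r' : R) : t = l ^+ 3 * t' -> r = l ^+ 2 * r' -> r' != 0 ->
    x * t ^+ 2 / r ^+ 3 = x * t' ^+ 2 / r' ^+ 3.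
  by move=> -> -> r0; field; rewrite r0 ln0.
have r0 : 'D_w ('D_w a) p != 0 by rewrite gt_eqF// posa.
rewrite /cubic_ratio /= wl; exact: (aux _ _ _ _ _ E3 (E2 _ Uz) r0).
Qed.

End LocalSpray.

(** The shape of the isotropy bracket, for a form that kills its three [frakB] terms. *)
Lemma linear_form_comb (R : pzRingType) (V : lmodType R) (g : V -> R)
    (c p1 p2 p3 t : R) (w1 w2 w3 w : V) :
  (forall v w, g (v + w) = g v + g w) -> (forall k v, g (k *: v) = k * g v) ->
  g w1 = 0 -> g w2 = 0 -> g w3 = 0 ->
  g (c *: (p1 *: w1 + p2 *: w2 + p3 *: w3 + t *: w)) = c * (t * g w).
Proof. by move=> gD gZ g1 g2 g3; rewrite gZ !gD !gZ g1 g2 g3 !mulr0 !add0r. Qed.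

Lemma sum3_reorder (R : comPzRingType) n (T : 'I_n -> 'I_n -> 'I_n -> R) (c : 'I_n -> R) :
  \sum_(j < n) \sum_(k < n) \sum_(l < n) T j k l * c j * c k * c l =
  \sum_(l < n) c l * \sum_(k < n) c k * \sum_(j < n) c j * T j k l.
Proof.
rewrite exchange_big /=.
under eq_bigr do rewrite exchange_big /=.
rewrite exchange_big /=; apply: eq_bigr => l _; rewrite mulr_sumr.
apply: eq_bigr => k _; rewrite !mulr_sumr; apply: eq_bigr => j _.
by rewrite [_ * c l]mulrC [_ * c k]mulrC [_ * c j]mulrC.
Qed.

(** * Charts of a Finsler manifold *)

Section Coordinates.
Context (R : realType) (n : nat) (M : manifold R n).
Local Notation E := 'rV[R]_n.
Implicit Types (i j : chart M) (x : M).

Lemma cod_phi i x : dom i x -> cod i (phi i x).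
Proof. by move=> dx; exists x. Qed.

Lemma dom_psi i (p : E) : cod i p -> dom i (psi i p).
Proof. by move=> [x dx <-]; rewrite phiK. Qed.

Lemma psiK i (p : E) : cod i p -> phi i (psi i p) = p.
Proof. by move=> [x dx <-]; rewrite phiK. Qed.

Lemma differentiable_transition i j x : dom i x -> dom j x ->
  differentiable (phi j \o psi i) (phi i x).
Proof.
move=> dix djx; have [+ _] := @transition_smooth _ _ M i j 1.
by apply; exists x.
Qed.

(** The chain rule for two transition maps whose composite is the identity only near [phi j x],
    where [psi j] stays in [dom i]. *)
Lemma diff_transitionK i j x (v : E) : dom i x -> dom j x ->
  'd (phi j \o psi i) (phi i x) ('d (phi i \o psi j) (phi j x) v) = v.
Proof.
move=> dix djx.
have df := differentiable_transition djx dix.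
have dg := differentiable_transition dix djx.
have fx : (phi i \o psi j) (phi j x) = phi i x by rewrite /= phiK.
have dg' : differentiable (phi j \o psi i) ((phi i \o psi j) (phi j x)) by rewrite fx.
have := diff_comp df dg'; rewrite fx => /(congr1 (fun f => f v)) /= <-.
rewrite -deriveE; last exact: differentiable_comp.
rewrite -[RHS](derive_id (phi j x) v); apply: near_eq_derive.
have n1 : \forall p \near phi j x, cod j p.
  apply: open_nbhs_nbhs; split; first exact: cod_open.
  exact: cod_phi.
have n2 : \forall p \near phi j x, dom i (psi j p).
  have := @psi_continuous _ _ M j (phi j x) (cod_phi djx).
  rewrite /prop_for /continuous_at phiK//; apply.
  by apply: open_nbhs_nbhs; split; first exact: dom_open.
near=> p; rewrite /=.
have cp : cod j p by near: p.
have dp : dom i (psi j p) by near: p.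
by rewrite phiK// psiK.
Unshelve. all: by end_near. Qed.

Lemma tvecK i x (v : E) : dom i x -> tcoord i (tvec i x v) = v.
Proof. by move=> dx; apply: diff_transitionK => //; exact: dom_chart_at. Qed.

Lemma tcoordK i x (y : tangent x) : dom i x -> tvec i x (tcoord i y) = y.
Proof. by move=> dx; apply: diff_transitionK => //; exact: dom_chart_at. Qed.

Lemma tvecD i x (v w : E) : tvec i x (v + w) = tvec i x v + tvec i x w.
Proof. exact: linearD. Qed.

Lemma tvecZ i x (c : R) (v : E) : tvec i x (c *: v) = c *: tvec i x v.
Proof. by rewrite /tvec linearZ. Qed.

Lemma tvec_eq0 i x (v : E) : dom i x -> (tvec i x v == 0) = (v == 0).
Proof.
move=> dx; apply/eqP/eqP => [v0|->]; last exact: linear0.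
by rewrite -(tvecK v dx) v0; exact: linear0.
Qed.

End Coordinates.

(** * The Finsler tensors as derivatives of the energy in a chart *)

Section FinslerCoordinates.
Context (R : realType) (n : nat) (M : manifold R n).
Local Notation E := 'rV[R]_n.
Variable F : forall x : M, tangent x -> R.
Hypothesis finslerF : finsler F.
Variable i : chart M.

Definition slit_cod : set (E * E) := [set p | cod i p.1 /\ p.2 != 0].
Definition energy (q : E * E) : R := local_fun F i q ^+ 2.
Local Notation U := slit_cod.
Local Notation a := energy.

Lemma open_slit_cod : open U.
Proof.
have -> : U = (fst @^-1` cod i) `&` (snd @^-1` [set y : E | y != 0]) by [].
apply: openI; apply: open_comp => //.
- by move=> p _; exact: cvg_fst.
- exact: cod_open.
- by move=> p _; exact: cvg_snd.
- have -> : [set y : E | y != 0] = ~` [set 0].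
    by apply/seteqP; split=> y /= /eqP.
  exact/closed_openC/accessible_closed_set1/hausdorff_accessible/norm_hausdorff.
Qed.
Let oU := open_slit_cod.

Lemma cone_slit_cod (l : R) p : 0 < l -> U p -> U (p.1, l *: p.2).
Proof. by move=> l0 [cp p0]; split=> //=; rewrite scaler_eq0 negb_or gt_eqF. Qed.

Lemma smooth_energy : smooth_on U a.
Proof.
have [_ sF _ _] := finslerF.
by apply: (smooth_ext oU _ (smoothM oU (sF i) (sF i))) => q _; rewrite -expr2.
Qed.
Let sa := smooth_energy.

Lemma energy_phi x (y : E) : dom i x -> a (phi i x, y) = F (tvec i x y) ^+ 2.
Proof. by move=> dx; rewrite /energy /local_fun /= phiK. Qed.

Lemma energy_homogeneous : fiber_homogeneous U 2 a.
Proof.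
move=> l p l0 [cp p0]; have [_ _ hF _] := finslerF.
by rewrite /energy /local_fun /= tvecZ hF// exprMn.
Qed.
Let ha := energy_homogeneous.

Lemma line_fiber (p y w : E) (t : R) : (p, y) + t *: (0, w) = (p, y + t *: w).
Proof. by rewrite -[LHS]/(p + t *: 0, y + t *: w) scaler0 addr0. Qed.

(** [tvec] is linear at fixed [x], and both sides are the same iterated limits, also at [y = 0].
    This lets [cartan_torsion_energy] identify two functions of [t] on a whole line, on which
    [y + t *: w] may vanish. *)
Lemma fund_tensor_energy x (y u v : E) : dom i x ->
  fund_tensor F (tvec i x y) (tvec i x u) (tvec i x v) =
  2^-1 * 'D_(0, u) ('D_(0, v) a) (phi i x, y).
Proof.
move=> dx.
have e : derive1 (fun s : R => derive1 (fun t : R =>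
    F (tvec i x y + s *: tvec i x u + t *: tvec i x v) ^+ 2 : R) 0 : R) 0 =
    'D_(0, u) ('D_(0, v) a) (phi i x, y).
  etransitivity; last exact: (derive1_line ('D_(0, v) a)).
  congr (derive1 _ 0); apply/funext => s.
  etransitivity; last exact: (derive1_line a).
  congr (derive1 _ 0); apply/funext => t.
  have e1 : (phi i x, y) + s *: (0, u) + t *: (0, v) = (phi i x, y + s *: u + t *: v).
    by rewrite (line_fiber (phi i x) y u s) line_fiber.
  have e2 := energy_phi (y + s *: u + t *: v) dx.
  by rewrite !tvecD !tvecZ -e1 in e2; rewrite -e2.
exact: (f_equal (fun z : R => 2^-1 * z) e).
Qed.

Lemma cartan_torsion_energy x (y u v w : E) : dom i x -> y != 0 ->
  cartan_torsion F (tvec i x y) (tvec i x u) (tvec i x v) (tvec i x w) =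
  4^-1 * 'D_(0, w) ('D_(0, u) ('D_(0, v) a)) (phi i x, y).
Proof.
move=> dx y0; have Uq : U (phi i x, y) by split => //; exact: cod_phi.
pose f q := 2^-1 * 'D_(0, u) ('D_(0, v) a) q.
have e : (fun t : R => fund_tensor F (tvec i x y + t *: tvec i x w) (tvec i x u) (tvec i x v)) =
    (fun t : R => f ((phi i x, y) + t *: (0, w))).
  apply/funext => t; rewrite -tvecZ -tvecD line_fiber.
  exact: (fund_tensor_energy (y + t *: w) u v dx).
have sD : smooth_on U ('D_(0, u) ('D_(0, v) a)) by exact/smooth_derive/smooth_derive.
have e' : derive1 (fun t : R => fund_tensor F (tvec i x y + t *: tvec i x w)
    (tvec i x u) (tvec i x v)) 0 = 2^-1 * 'D_(0, w) ('D_(0, u) ('D_(0, v) a)) (phi i x, y).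
  rewrite e; etransitivity; first exact: (derive1_line f).
  exact: (smooth_derive_eqZ oU 2^-1 sD Uq erefl).
have aux (r z : R) : r = 2^-1 * z -> 2^-1 * r = 4^-1 * z by move=> ->; field.
exact: (aux _ _ e').
Qed.

Lemma energy_posdef (w : E) q : U q -> w != 0 -> 0 < 'D_(0, w) ('D_(0, w) a) q.
Proof.
case: q => p y [/= cp y0] w0; have [_ _ _ pF] := finslerF.
have dx := dom_psi cp.
have := pF _ (tvec i (psi i p) y) _ (tvec i (psi i p) w).
rewrite !tvec_eq0// => /(_ y0 w0); rewrite fund_tensor_energy// psiK//.
by rewrite pmulr_rgt0// invr_gt0.
Qed.

Lemma euler_energy q : U q -> 'D_(0, q.2) a q = 2 * a q.
Proof. by move=> Uq; rewrite (euler_identity ha sa Uq). Qed.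

Lemma euler_energy_derive (v : E) q : U q ->
  'D_(0, q.2) ('D_(0, v) a) q = 'D_(0, v) a q.
Proof.
move=> Uq; have h1 := fiber_homogeneous_fiber oU cone_slit_cod v ha sa.
by rewrite (euler_identity h1 (smooth_derive _ sa) Uq) mul1r.
Qed.

(** [finsler] only states [0 <= F]; two Euler identities rewrite [2 * a] as the Hessian of [a] on
    [y], which is positive. *)
Lemma energy_gt0 q : U q -> 0 < a q.
Proof.
move=> Uq; have := energy_posdef Uq (proj2 Uq).
rewrite euler_energy_derive// euler_energy//.
by rewrite pmulr_rgt0.
Qed.

Lemma fund_mxE q : U q -> fund_mx F i q = half_hessian a q.
Proof.
case: q => p y [/= cp y0]; apply/matrixP => j k; rewrite [LHS]mxE [RHS]mxE.
have := fund_tensor_energy y (delta_mx 0 j) (delta_mx 0 k) (dom_psi cp).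
by rewrite psiK.
Qed.

Lemma sprayE b q : U q -> spray F i b q = local_spray a b q.
Proof. by move=> Uq; rewrite /spray fund_mxE. Qed.

Lemma berwald_coefE b j k l q : U q ->
  berwald_coef F i b j k l q = dy j (dy k (dy l (local_spray a b))) q.
Proof.
move=> Uq; rewrite /berwald_coef.
apply: (derive_on_open oU _ Uq) => q1 U1; apply: (derive_on_open oU _ U1) => q2 U2.
by apply: (derive_on_open oU _ U2) => q3 U3; exact: sprayE.
Qed.

Lemma berwald_curvature_energy x (y u : E) : dom i x -> y != 0 ->
  berwald_curvature F i (tvec i x y) (tvec i x u) (tvec i x u) (tvec i x u) =
  tvec i x (\row_b 'D_(0, u) ('D_(0, u) ('D_(0, u) (local_spray a b))) (phi i x, y)).
Proof.
move=> dx y0; have Uq : U (phi i x, y) by split => //; exact: cod_phi.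
rewrite /berwald_curvature !tvecK//; congr (tvec i x _); apply/rowP => b.
rewrite [LHS]mxE [RHS]mxE; symmetry.
etransitivity; first exact: (derive3_fiber oU u (smooth_local_spray oU sa energy_posdef b) Uq).
rewrite -sum3_reorder; apply: eq_bigr => j _; apply: eq_bigr => k _; apply: eq_bigr => l _.
exact: (f_equal (fun z : R => z * u 0 j * u 0 k * u 0 l) (esym (berwald_coefE b j k l Uq))).
Qed.

Lemma fund_tensor_radial x (y v : E) : dom i x -> y != 0 ->
  fund_tensor F (tvec i x y) (tvec i x v) (tvec i x y) =
  2^-1 * 'D_(0, v) a (phi i x, y).
Proof.
move=> dx y0; have Uq : U (phi i x, y) by split => //; exact: cod_phi.
etransitivity; first exact: fund_tensor_energy.
congr (_ * _); etransitivity; last exact: (euler_energy_derive v Uq).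
exact: (smooth_derive_comm oU (0, v) (0, y) sa Uq).
Qed.

(** Apply the form [gy], that is [g_y(., y)], to the isotropy condition at [u = v = w]. By
    [fund_tensor_radial] it is half the vertical differential of the energy. It kills every [frakB]
    term because [g_y(ell, ell) = 1], and [gy ell = F], so only the Cartan term remains. *)
Lemma isotropic_contraction (Phi : M -> R) x (y u : E) :
  isotropic_berwald F Phi -> dom i x -> y != 0 ->
  \sum_(b < n) 'D_(0, u) ('D_(0, u) ('D_(0, u) (local_spray a b))) (phi i x, y)
     * dy b a (phi i x, y) =
  (Phi x * F (tvec i x y)) * 'D_(0, u) ('D_(0, u) ('D_(0, u) a)) (phi i x, y).
Proof.
move=> iso dx y0; have Uq : U (phi i x, y) by split => //; exact: cod_phi.
set q := (phi i x, y).
pose Y := tvec i x y; pose W := tvec i x u.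
have FY0 : F Y != 0.
  apply/eqP => FY; have := energy_gt0 Uq.
  by rewrite energy_phi// -/Y FY expr0n ltxx.
pose gy (w : tangent x) : R := fund_tensor F Y w Y.
have gyE w : gy w = 2^-1 * 'D_(0, tcoord i w) a q.
  by rewrite /gy -{1}(tcoordK w dx); exact: fund_tensor_radial.
have gyD v w : gy (v + w) = gy v + gy w.
  rewrite !gyE -mulrDr; congr (_ * _).
  rewrite -(smooth_derive_dirD _ _ sa Uq); congr ('D_ _ a q).
  by rewrite /tcoord linearD -[RHS]/(0 + 0, _) addr0.
have gyZ c w : gy (c *: w) = c * gy w.
  rewrite !gyE mulrCA; congr (_ * _).
  rewrite -(smooth_derive_dirZ _ _ sa Uq); congr ('D_ _ a q).
  by rewrite /tcoord linearZ -[RHS]/(c *: 0, _) scaler0.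
have gyY : gy Y = F Y ^+ 2.
  rewrite gyE tvecK// (euler_energy Uq) mulrA mulVf ?pnatr_eq0// mul1r.
  exact: energy_phi.
have gyl : gy (ell F Y) = F Y by rewrite gyZ gyY expr2 mulKf.
have gl w : fund_tensor F Y w (ell F Y) = (F Y)^-1 * gy w.
  rewrite /ell /gy -(tcoordK w dx) -tvecZ; set r := tcoord i w; set c := (F Y)^-1.
  have sy : smooth_on U ('D_(0, y) a) by exact: smooth_derive.
  have e1 : 'D_(0, r) ('D_(0, c *: y) a) q = c * 'D_(0, r) ('D_(0, y) a) q.
    etransitivity; last exact: (smooth_derive_eqZ oU c sy Uq erefl).
    apply: (derive_on_open oU (0, r) Uq) => p Up.
    rewrite -(smooth_derive_dirZ _ _ sa Up); congr ('D_ _ a p).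
    by rewrite -[RHS]/(c *: 0, c *: y) scaler0.
  have aux (z1 z2 d1 d2 : R) : z1 = 2^-1 * d1 -> z2 = 2^-1 * d2 -> d1 = c * d2 -> z1 = c * z2.
    by move=> -> -> ->; rewrite mulrCA.
  exact: (aux _ _ _ _ (fund_tensor_energy y r (c *: y) dx) (fund_tensor_energy y r y dx) e1).
have gB w : gy (frakB F Y w) = 0.
  rewrite /frakB -scaleN1r gyD gyZ gyZ gl gyl.
  by rewrite mulN1r mulrAC mulVf// mul1r subrr.
have Y0 : Y != 0 by rewrite /Y tvec_eq0.
have eR (c p1 p2 p3 t : R) w1 w2 w3 : gy (c *: (p1 *: frakB F Y w1 +
    p2 *: frakB F Y w2 + p3 *: frakB F Y w3 + t *: ell F Y)) = c * (t * F Y).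
  etransitivity; first exact: (linear_form_comb _ _ _ _ _ _ gyD gyZ (gB _) (gB _) (gB _)).
  exact: (f_equal (fun z : R => c * (t * z)) gyl).
have eL (r : E) : gy (tvec i x r) = 2^-1 * \sum_(k < n) r 0 k * dy k a q.
  by rewrite gyE tvecK// (derive_fiber _ sa Uq).
have e := congr1 gy (iso i x dx Y Y0 W W W).
have e1 := etrans (esym (eL _)) (etrans (congr1 gy (esym
  (berwald_curvature_energy u dx y0))) (etrans e (eR _ _ _ _ _ _ _ _))).
have e2 := cartan_torsion_energy u u u dx y0.
have e3 : \sum_(b < n) 'D_(0, u) ('D_(0, u) ('D_(0, u) (local_spray a b))) q
    * dy b a q = \sum_(b < n) (\row_b 'D_(0, u) ('D_(0, u) ('D_(0, u) (local_spray a b))) q)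
    0 b * dy b a q.
  by apply: eq_bigr => b _; rewrite mxE.
have aux (P f z z' C t : R) : f != 0 -> z = z' -> C = 4^-1 * t ->
    2^-1 * z' = P * f^-1 * (2 * f * C * f) -> z = P * f * t.
  move=> f0 -> -> h; have -> : z' = 2 * (2^-1 * z') by field.
  by rewrite h; field.
exact: (aux _ _ _ _ _ _ FY0 e3 e2 e1).
Qed.

End FinslerCoordinates.

(** * The maximum of the torsion ratio *)

(* Otherwise the complements of the sets satisfying P form a proper filter. *)
Lemma compact_local_to_global (T : topologicalType) (P : set T -> Prop) :
  compact [set: T] -> P set0 -> (forall A B, P A -> P B -> P (A `|` B)) ->
  (forall A B, A `<=` B -> P B -> P A) -> (forall x : T, exists2 N, nbhs x N & P N) ->
  P [set: T].
Proof.
move=> cT P0 PU Psub Ploc; apply: contrapT => nPT.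
pose G : set_system T := fun S => P (~` S).
have FG : ProperFilter G.
  apply: Build_ProperFilter; first by rewrite /G /= setC0.
  split; rewrite /G.
  - by rewrite setCT.
  - by move=> A B PA PB; rewrite setCI; exact: PU.
  - by move=> A B AB; apply: Psub; exact: subsetC.
have GT : G [set: T] by rewrite /G setCT.
have [x [_ clx]] := cT G FG GT.
have [N Nx PN] := Ploc x.
have GN : G (~` N) by rewrite /G setCK.
by have [y []] := clx _ _ GN Nx.
Qed.

Lemma compact_unit_sphere (R : realType) n : compact [set v : 'rV[R]_n | `|v| = 1].
Proof.
apply: bounded_closed_compact.
  exists 1; split; first exact: num_real.
  by move=> e e1 v /= ->; exact: ltW.
apply: (@preimage_closed _ _ (fun v : 'rV[R]_n => `|v|) [set 1]).
  by move=> v _; exact: norm_continuous.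
exact: closed_eq.
Qed.

Lemma compact_closed_norm_ball (R : realType) n (p : 'rV[R]_n) (r : R) :
  compact [set v : 'rV[R]_n | `|v - p| <= r].
Proof.
apply: bounded_closed_compact.
  exists (`|p| + r); split; first exact: num_real.
  move=> e re v /= vr; apply: le_trans (ltW re).
  by rewrite -[v](subrK p) addrC (le_trans (ler_normD _ _))// lerD2l.
apply: (@preimage_closed _ _ (fun v : 'rV[R]_n => `|v - p|) [set t | t <= r]).
  move=> v _.
  have c : {for v, continuous (fun v : 'rV[R]_n => v - p)}.
    by apply: continuousB; [exact: cvg_id|exact: cst_continuous].
  exact: (continuous_comp c (@norm_continuous _ _ _)).
exact: closed_le.
Qed.

Section GlobalMaximum.
Context (R : realType) (n : nat) (M : manifold R n).
Local Notation E := 'rV[R]_n.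
Variable F : forall x : M, tangent x -> R.
Hypothesis finslerF : finsler F.

(** A chart-free version of [cubic_ratio], so that maxima found in different charts can be
    compared. *)
Definition torsion_ratio x (y u : tangent x) : R :=
  F y ^+ 2 * cartan_torsion F y u u u ^+ 2 / fund_tensor F y u u ^+ 3.

(** The factor is [(1/4)^2 / (1/2)^3], from the constants in the Cartan torsion and the fundamental
    tensor. *)
Lemma torsion_ratio_chart i x (y u : E) : dom i x -> y != 0 ->
  torsion_ratio (tvec i x y) (tvec i x u) =
  2^-1 * cubic_ratio (energy F i) ((phi i x, y), u).
Proof.
move=> dx y0.
have aux (f a t t' r r' : R) : f = a -> t = 4^-1 * t' -> r = 2^-1 * r' ->
    f * t ^+ 2 / r ^+ 3 = 2^-1 * (a * t' ^+ 2 / r' ^+ 3).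
  by move=> -> -> ->; rewrite !exprMn invfM; move: (r' ^+ 3)^-1 => z; field.
exact: (aux _ _ _ _ _ _ (esym (energy_phi _ _ dx))
  (cartan_torsion_energy finslerF u u u dx y0) (fund_tensor_energy _ y u u dx)).
Qed.

(** The dominating point may lie outside [A], which makes the property pass to subsets; on all of
    [M] it is the existence of a maximum. *)
Definition torsion_dominated (A : set M) := exists (x : M) (y u : tangent x),
  [/\ y != 0, u != 0 & forall x' (y' u' : tangent x'), A x' -> y' != 0 -> u' != 0 ->
    torsion_ratio y' u' <= torsion_ratio y u].

Lemma torsion_dominated_setU A B :
  torsion_dominated A -> torsion_dominated B -> torsion_dominated (A `|` B).
Proof.
move=> [x [y [u [y0 u0 hA]]]] [x' [y' [u' [y'0 u'0 hB]]]].
have [le|/ltW le] := leP (torsion_ratio y u) (torsion_ratio y' u').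
- exists x', y', u'; split; [exact: y'0|exact: u'0|move=> z v w [Az|Bz] v0 w0].
  + exact: le_trans (hA z v w Az v0 w0) le.
  + exact: (hB z v w Bz v0 w0).
- exists x, y, u; split; [exact: y0|exact: u0|move=> z v w [Az|Bz] v0 w0].
  + exact: (hA z v w Az v0 w0).
  + exact: le_trans (hB z v w Bz v0 w0) le.
Qed.

(** In a chart, [cubic_ratio] attains a maximum on a closed ball times two unit spheres, and by
    homogeneity this bounds it on all nonzero pairs over the ball. The vector [y] witnesses that the
    spheres are nonempty. *)
Lemma torsion_dominated_near (x : M) (y : tangent x) : y != 0 ->
  exists2 N, nbhs x N & torsion_dominated N.
Proof.
move=> y0; pose i := chart_at x; have dx : dom i x := dom_chart_at x.
pose p := phi i x.
have [e /= e0 ecod] : exists2 e : R, 0 < e & [set v : E | `|v - p| <= e] `<=` cod i.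
  have : nbhs p (cod i).
    by apply: open_nbhs_nbhs; split; [exact: cod_open|exact: cod_phi].
  move=> /nbhs_ballP[e /= e0 ep]; exists (e / 2); first by rewrite divr_gt0.
  move=> v /= ve; apply: ep; rewrite -ball_normE /= distrC.
  by rewrite (le_lt_trans ve)// ltr_pdivrMr// ltr_pMr// ltr1n.
pose K1 := [set v : E | `|v - p| <= e]; pose S := [set v : E | `|v| = 1].
have Snz (v : E) : S v -> v != 0.
  by move=> /= v1; rewrite -normr_gt0 v1.
pose nrm (v : E) := `|v|^-1 *: v.
have nrm_pos (v : E) : v != 0 -> 0 < `|v|^-1 by move=> v0; rewrite invr_gt0 normr_gt0.
have nrmS (v : E) : v != 0 -> S (nrm v).
  by move=> v0; rewrite /S /nrm /= normrZ normfV normr_id mulVf// normr_eq0.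
have cK : compact ((K1 `*` S) `*` S).
  apply: compact_setX; last exact: compact_unit_sphere.
  apply: compact_setX; last exact: compact_unit_sphere.
  exact: compact_closed_norm_ball.
have K0 : ((K1 `*` S) `*` S) !=set0.
  exists ((p, nrm y), nrm y); split; last exact: nrmS.
  by split; [rewrite /K1 /= subrr normr0 ltW|exact: nrmS].
have KU z : ((K1 `*` S) `*` S) z -> slit_cod i z.1 /\ z.2 != 0.
  by move=> [[z1 z2] z3]; split; [split; [exact: ecod|exact: Snz]|exact: Snz].
pose f := cubic_ratio (energy F i).
have cf : {within ((K1 `*` S) `*` S), continuous f}.
  apply: continuous_in_subspaceT => z /set_mem /KU [Uz z0].
  exact: (continuous_cubic_ratio (@open_slit_cod _ _ _ i) (@smooth_energy _ _ _ _ finslerF i)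
    (@energy_posdef _ _ _ _ finslerF i) Uz z0).
have [[[q v] w] /set_mem Kc fmax] := compact_EVT_max K0 cK cf.
have [[/= cq v0] w0] := KU _ Kc.
have dq := dom_psi cq.
exists (dom i `&` (phi i @^-1` K1)).
  apply: filterI; first by apply: open_nbhs_nbhs; split => //; exact: dom_open.
  have := phi_continuous dx; rewrite /prop_for /continuous_at; apply.
  apply/nbhs_ballP; exists e => // v' /=; rewrite -ball_normE /= distrC => h.
  exact: ltW.
exists (psi i q), (tvec i (psi i q) v), (tvec i (psi i q) w).
split; [by rewrite (tvec_eq0 v dq)|by rewrite (tvec_eq0 w dq)|].
move=> x' y' u' [dx' Kx'] y'0 u'0.
have ty0 : tcoord i y' != 0 by rewrite -(tvec_eq0 _ dx') tcoordK.
have tu0 : tcoord i u' != 0 by rewrite -(tvec_eq0 _ dx') tcoordK.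
have Ux' : slit_cod i (phi i x', tcoord i y') by split => //; exact: cod_phi.
have Ux'' : slit_cod i (phi i x', nrm (tcoord i y')).
  by split => /=; [exact: cod_phi|exact/Snz/nrmS].
have e1 := cubic_ratio_scale_base (@open_slit_cod _ _ _ i) (@smooth_energy _ _ _ _ finslerF i)
  (@cone_slit_cod _ _ _ i) (@energy_homogeneous _ _ _ _ finslerF i)
  (z := ((phi i x', tcoord i y'), tcoord i u')) (nrm_pos _ ty0) Ux'.
have e2 := cubic_ratio_scale_dir (@open_slit_cod _ _ _ i) (@smooth_energy _ _ _ _ finslerF i)
  (@energy_posdef _ _ _ _ finslerF i)
  (z := ((phi i x', nrm (tcoord i y')), tcoord i u')) (nrm_pos _ tu0) Ux'' tu0.
have fle := fmax ((phi i x', nrm (tcoord i y')), nrm (tcoord i u')).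
have ratio' := torsion_ratio_chart (tcoord i u') dx' ty0.
have ratio := torsion_ratio_chart w dq v0.
rewrite (psiK cq) in ratio; rewrite (tcoordK y' dx') (tcoordK u' dx') in ratio'.
have aux (r r' c c' b' d' : R) : r' = 2^-1 * c' -> r = 2^-1 * c -> b' = c' ->
    d' = b' -> d' <= c -> r' <= r.
  by move=> -> -> <- <-; rewrite ler_pM2l// invr_gt0.
apply: (aux _ _ _ _ _ _ ratio' ratio e1 e2); apply: fle; apply/mem_set.
by split; [split; [exact: Kx'|exact: nrmS]|exact: nrmS].
Qed.

End GlobalMaximum.

Lemma fiber_polarization (R : realType) n (U : set ('rV[R]_n * 'rV[R]_n))
    (f : 'rV[R]_n * 'rV[R]_n -> R) : open U -> smooth_on U f ->
  (forall (v : 'rV[R]_n) q, U q -> 'D_(0, v) ('D_(0, v) ('D_(0, v) f)) q = 0) ->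
  forall (u v w : 'rV[R]_n) q, U q -> 'D_(0, u) ('D_(0, v) ('D_(0, w) f)) q = 0.
Proof.
move=> oU sf f0 u v w q Uq.
pose T (u v w : 'rV[R]_n) : R := 'D_(0, u) ('D_(0, v) ('D_(0, w) f)) q.
have sD a b : smooth_on U ('D_a ('D_b f)) by exact/smooth_derive/smooth_derive.
apply: (@trilinear_polarization R _ T) => [{}u u' {}v {}w|{}u {}v {}w|{}u {}v {}w|{}v].
- rewrite /T; have -> : (0 : 'rV[R]_n, u + u') = (0, u) + (0, u').
    by rewrite -[RHS]/(0 + 0, u + u') addr0.
  exact: (smooth_derive_dirD _ _ (sD _ _) Uq).
- exact: (smooth_derive_comm oU _ _ (smooth_derive (0, w) sf) Uq).
- exact: (smooth_derive3_comm oU _ _ _ sf Uq).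
- exact: f0.
Qed.

(** * From vanishing torsion to vanishing Berwald curvature *)

Section VanishingTorsion.
Context (R : realType) (n : nat) (M : manifold R n).
Local Notation E := 'rV[R]_n.
Variable F : forall x : M, tangent x -> R.
Hypothesis finslerF : finsler F.

Lemma cubic_ratio_zero (i : chart M) q (v : E) : slit_cod i q -> v != 0 ->
  cubic_ratio (energy F i) (q, v) <= 0 ->
  'D_(0, v) ('D_(0, v) ('D_(0, v) (energy F i))) q = 0.
Proof.
move=> Uq v0.
have Q0 := energy_posdef finslerF Uq v0; have A0 := energy_gt0 finslerF Uq.
have aux (x t r : R) : 0 < x -> 0 < r -> x * t ^+ 2 / r ^+ 3 <= 0 -> t = 0.
  move=> x0 r0; rewrite pmulr_lle0 ?invr_gt0 ?exprn_gt0// pmulr_rle0//.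
  by move=> t0; apply/eqP; rewrite -sqrf_eq0 eq_le t0 sqr_ge0.
exact: aux.
Qed.

(** By polarization only diagonal third derivatives of [G] matter. They form a vector [r] orthogonal
    to every direction for the Hessian of the energy; taking [r] itself as the direction contradicts
    positivity unless [r = 0]. *)
Lemma berwald_of_vanishing_torsion (i : chart M) :
  (forall (v : E) q, slit_cod i q ->
    'D_(0, v) ('D_(0, v) ('D_(0, v) (energy F i))) q = 0) ->
  forall b j k l q, slit_cod i q -> berwald_coef F i b j k l q = 0.
Proof.
move=> a0 b j k l q Uq.
have oU := @open_slit_cod _ _ _ i.
have sa := @smooth_energy _ _ _ _ finslerF i.
have pa := @energy_posdef _ _ _ _ finslerF i.
have sG := smooth_local_spray oU sa pa.
have a3 := fiber_polarization oU sa a0.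
rewrite (berwald_coefE F b j k l Uq).
apply: (fiber_polarization oU (sG b)) Uq => v {}q Uq.
pose r : E := \row_b 'D_(0, v) ('D_(0, v) ('D_(0, v) (local_spray (energy F i) b))) q.
suff r0 : r = 0 by move/rowP/(_ b): r0; rewrite !mxE.
apply/eqP/negPn/negP => rn0; have := pa r q Uq rn0.
have e1 := derive_fiber r (smooth_derive (0, r) sa) Uq.
have e2 := spray_third_derivative_orthogonal oU sa sG (euler_lagrange oU sa pa) a3 v r Uq.
suff e3 : 'D_(0, r) ('D_(0, r) (energy F i)) q = 0 by rewrite e3 ltxx.
etransitivity; first exact: e1.
etransitivity; last exact: e2.
by apply: eq_bigr => c _; rewrite mxE.
Qed.

End VanishingTorsion.

Theorem theorem1p3 (R : realType) (n : nat) (M : manifold R n)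
    (compactM : compact [set: M])
    (F : forall x : M, tangent x -> R) (finslerF : finsler F)
    (Phi : M -> R) (smoothPhi : smooth_fun Phi)
    (isotropicF : isotropic_berwald F Phi)
    (c0 : R)
    (signPhi : (0 < c0 /\ forall x : M, c0 <= Phi x) \/
               (c0 < 0 /\ forall x : M, Phi x <= c0)) :
  berwald_metric F.
Proof.
move=> i x dx y y0.
have Phi0 z : Phi z != 0.
  case: signPhi => [[c1 h]|[c1 h]]; first by rewrite gt_eqF// (lt_le_trans c1).
  by rewrite lt_eqF// (le_lt_trans _ c1).
have [x1 [y1 [u1 [y10 u10 hmax]]]] : torsion_dominated F [set: M].
  apply: compact_local_to_global compactM _ _ _ _.
  - by exists x, y, y; split; [exact: y0|exact: y0|move=> ? ? ? []].
  - exact: torsion_dominated_setU.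
  - move=> A B AB [z [v [w [v0 w0 h]]]]; exists z, v, w; split; [exact: v0|exact: w0|].
    by move=> z' v' w' /AB; exact: h.
  (* [tangent] is the same module at every point, so [y] also serves as a nonzero vector at [z]. *)
  - by move=> z; exact: (@torsion_dominated_near _ _ _ _ finslerF z y y0).
have max0 : torsion_ratio F y1 u1 <= 0.
  pose j := chart_at x1; have dj : dom j x1 := dom_chart_at x1.
  pose v1 := tcoord j y1; pose w1 := tcoord j u1.
  have v10 : v1 != 0 by rewrite -(tvec_eq0 v1 dj) tcoordK.
  have w10 : w1 != 0 by rewrite -(tvec_eq0 w1 dj) tcoordK.
  pose q1 := (phi j x1, v1).
  have Uq1 : slit_cod j q1 by split => //; exact: cod_phi.
  have e1 := torsion_ratio_chart finslerF w1 dj v10.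
  rewrite (tcoordK y1 dj) (tcoordK u1 dj) in e1.
  have oU := @open_slit_cod _ _ _ j.
  have sa := @smooth_energy _ _ _ _ finslerF j.
  have pa := @energy_posdef _ _ _ _ finslerF j.
  have sG := smooth_local_spray oU sa pa.
  have Q0 := pa _ _ Uq1 w10; have A0 := energy_gt0 finslerF Uq1.
  have F0 : F x1 y1 != 0.
    have := energy_phi F v1 dj; rewrite (tcoordK y1 dj) => e.
    by apply/eqP => F0; move: A0; rewrite e F0 expr0n ltxx.
  have iso := isotropic_contraction finslerF w1 isotropicF dj v10.
  rewrite (tcoordK y1 dj) in iso.
  (* The rate [c] is [Phi x1 * F x1 y1], nonzero, and [M] is the value of the chart ratio at the
     maximum. *)
  have := cubic_zero_at_max oU (@cone_slit_cod _ _ _ j) sa sG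
    (@energy_homogeneous _ _ _ _ finslerF j) (euler_lagrange oU sa pa) Uq1
    (mulf_neq0 (Phi0 x1) F0) A0 iso
    (M := cubic_ratio (energy F j) (q1, w1)).
  have aux (r m t : R) : 0 < r -> t / r ^+ 3 <= m -> t <= m * r ^+ 3.
    by move=> r0; rewrite ler_pdivrMr// exprn_gt0.
  have maxj p (v : 'rV[R]_n) : slit_cod j p ->
      energy F j p * 'D_(0, v) ('D_(0, v) ('D_(0, v) (energy F j))) p ^+ 2 <=
      cubic_ratio (energy F j) (q1, w1) * 'D_(0, v) ('D_(0, v) (energy F j)) p ^+ 3.
    (* The moving direction of [cubic_zero_at_max] is not known to avoid 0, so the cross-multiplied
       bound is also checked at [v = 0], where both sides vanish. *)
    move=> Up; have [->|v0] := eqVneq v 0.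
      have -> : 'D_(0, 0) ('D_(0, 0) ('D_(0, 0) (energy F j))) p = 0 by exact: derive0.
      have -> : 'D_(0, 0) ('D_(0, 0) (energy F j)) p = 0 by exact: derive0.
      by rewrite !expr0n !mulr0.
    case: p Up => p1 p2 [cp p20].
    have Q1 := pa _ (p1, p2) (conj cp p20) v0.
    apply: (aux _ _ _ Q1).
    have dp := dom_psi cp.
    have := hmax (psi j p1) (tvec j _ p2) (tvec j _ v) I.
    rewrite (tvec_eq0 p2 dp) (tvec_eq0 v dp) => /(_ p20 v0).
    rewrite (torsion_ratio_chart finslerF v dp p20) e1 (psiK cp).
    by rewrite ler_pM2l// invr_gt0.
  move=> /(_ maxj) zero.
  have T0 : 'D_(0, w1) ('D_(0, w1) ('D_(0, w1) (energy F j))) q1 = 0.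
    by apply: zero; rewrite divfK// expf_neq0// gt_eqF.
  rewrite e1 /cubic_ratio /=.
  have -> : 'D_(0, w1) ('D_(0, w1) ('D_(0, w1) (energy F j))) (phi j x1, v1) = 0.
    exact: T0.
  by rewrite expr0n mulr0 mul0r mulr0.
have a0 (v : 'rV[R]_n) q : slit_cod i q ->
    'D_(0, v) ('D_(0, v) ('D_(0, v) (energy F i))) q = 0.
  move=> Uq; have [->|v0] := eqVneq v 0; first exact: derive0.
  apply: (cubic_ratio_zero finslerF Uq v0).
  case: q Uq => p1 p2 [cp p20]; have dp := dom_psi cp.
  have := hmax (psi i p1) (tvec i _ p2) (tvec i _ v) I.
  rewrite (tvec_eq0 p2 dp) (tvec_eq0 v dp) => /(_ p20 v0) le1.
  have := le_trans le1 max0.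
  rewrite (torsion_ratio_chart finslerF v dp p20) (psiK cp).
  by rewrite pmulr_rle0// invr_gt0.
move=> u v w; rewrite /berwald_curvature.
have yc : tcoord i y != 0 by rewrite -(tvec_eq0 _ dx) tcoordK.
have Uy : slit_cod i (phi i x, tcoord i y) by split => //; exact: cod_phi.
set r := (X in tvec i x X); suff -> : r = 0 by exact: linear0.
apply/rowP => b; rewrite !mxE.
apply: big1 => j _; apply: big1 => k _; apply: big1 => l _.
by rewrite (berwald_of_vanishing_torsion finslerF a0 b j k l Uy) !mul0r.
Qed.
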